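(* Let $r$ be a positive integer and $s\in\mu_r$. For every $w\in\mathcal{A}^1_{\mu_r,>0}$, every $w'\in\mathcal{A}^1_{\{1\},>0}$ and every integer $m\ge 0$, $$\sum_{\substack{k+l=m\\ k\ge 0,\ l>0}}\mathcal{L}^{\mathrm{sh}}\Bigl(L_x^{-1}\mathcal{I}\bigl(\mathcal{I}^{-1}L_{x+\delta(s)y_s}\varphi\mathcal{I}M_s(w)\ \dot{\ast}\ y_1^{k+1}\bigr)\Bigr)\,\mathcal{L}^{\mathrm{sh}}\Bigl(L_x^{-1}\bigl(L_x\varphi(w')\ \dot{\ast}\ y_1^{l}\bigr)\Bigr)=\mathcal{L}^{\mathrm{sh}}\Bigl(L_x^{-1}\mathcal{I}\bigl(\mathcal{I}^{-1}L_{x+\delta(s)y_s}\varphi\mathcal{I}M_s(w\ast w')\ \dot{\ast}\ y_1^{m+1}\bigr)\Bigr),$$ where for $m=0$ the left-hand side is $0$.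
   Context: Let $\mu_r$ be the group of $r$-th roots of unity. For a multiplicative group (or multiplicatively closed set) $\Lambda$, $\mathcal{A}_\Lambda=\mathbb{Q}\langle x,y_s\mid s\in\Lambda\rangle$ is the free non-commutative algebra; $\mathcal{A}^1_\Lambda=\mathbb{Q}+\sum_{s\in\Lambda}\mathcal{A}_\Lambda y_s$, $\mathcal{A}^0_\Lambda=\mathbb{Q}+\sum_{s\in\Lambda}x\mathcal{A}_\Lambda y_s+\sum_{s,t\in\Lambda,\,t\ne1}y_t\mathcal{A}_\Lambda y_s$, and $\mathcal{A}^1_{\Lambda,>0}$ is the set of elements of $\mathcal{A}^1_\Lambda$ with no constant term; $\mathcal{A}_{\{1\}}\subset\mathcal{A}_{\mu_r}$. Write $z_{k,s}=x^{k-1}y_s$; every word of positive degree is uniquely $z_{k_1,s_1}\cdots z_{k_n,s_n}x^l$. $\delta(s)=0$ if $s\in\{0,1\}$, $\delta(s)=1$ otherwise. $\varphi$ is the algebra automorphism with $\varphi(x)=x+y_1$, $\varphi(y_s)=\delta(s)y_s-y_1$. $\mathcal{I},\mathcal{I}^{-1},M_s$ are the $\mathbb{Q}$-linear maps on words of positive degree given by $\mathcal{I}(z_{k_1,s_1}\cdots z_{k_n,s_n}x^l)=z_{k_1,s_1}z_{k_2,s_1s_2}\cdots z_{k_n,s_1\cdots s_n}x^l$, $\mathcal{I}^{-1}(z_{k_1,s_1}\cdots z_{k_n,s_n}x^l)=z_{k_1,s_1}z_{k_2,s_2/s_1}\cdots z_{k_n,s_n/s_{n-1}}x^l$, $M_s(z_{k_1,s_1}\cdots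 z_{k_n,s_n}x^l)=z_{k_1,ss_1}z_{k_2,s_2}\cdots z_{k_n,s_n}x^l$. $L_u(v)=uv$, and $L_x^{-1}$ removes a leading letter $x$ (applied to elements of $x\mathcal{A}_{\mu_r}$; the arguments of $\mathcal{L}^{\mathrm{sh}}$ above are elements of $\mathcal{A}^0_{\mu_r}$). The harmonic product $\ast$ on $\mathcal{A}^1_\Lambda$ is $\mathbb{Q}$-bilinear with $1\ast w=w\ast1=w$ and $z_{k,s}w\ast z_{l,t}w'=z_{k,s}(w\ast z_{l,t}w')+z_{l,t}(z_{k,s}w\ast w')+z_{k+l,st}(w\ast w')$; the product $\dot\ast$ is $\mathbb{Q}$-bilinear with $1\,\dot\ast\,w=w\,\dot\ast\,1=w$ and $z_{k,s}w\,\dot\ast\,z_{l,t}w'=z_{k+l,st}(w\ast w')$ (words $w,w'$). $\mathcal{L}^{\mathrm{sh}}:\mathcal{A}^0_{\mu_r}\to\mathbb{C}$ is the $\mathbb{Q}$-linear map with $\mathcal{L}^{\mathrm{sh}}(1)=1$ and $\mathcal{L}^{\mathrm{sh}}(x^{k_1-1}y_{s_1}\cdots x^{k_n-1}y_{s_n})=\lim_{M\to\infty}\sum_{M>m_1>\cdots>m_n>0}\frac{s_1^{m_1-m_2}\cdots s_{n-1}^{m_{n-1}-m_n}s_n^{m_n}}{m_1^{k_1}\cdots m_n^{k_n}}$ (multiple $L$-value of shuffle type). *)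

(* Defs.v *)
From mathcomp Require Import all_boot all_order all_algebra all_classical all_reals all_analysis.
From mathcomp Require Import complex.
From Stdlib Require List.
Import numFieldNormedType.Exports.

Set Implicit Arguments.
Unset Strict Implicit.
Unset Printing Implicit Defensive.

Import Order.TTheory GRing.Theory Num.Theory.
Local Open Scope classical_set_scope.
Local Open Scope ring_scope.

(* The complex numbers: R[i] over an arbitrary real type R (e.g. R = Rstruct  *)
(* reals), equipped (via the regular alias ^o) with its normed topology.     *)
Definition Cplx (R : realType) := (R[i])^o.

Section FreeAlgebra.
Variable R : realType.
Local Notation C := (Cplx R).

Inductive letter := Lx | Ly of C.

Definition word := seq letter.

(* Elements of the free Q-algebra A = Q<x, y_s> are represented as formal    *)
(* Q-linear combinations of words (finite lists of (coefficient, word)).     *)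
(* All maps below are defined word-wise and extended linearly, so they are   *)
(* well defined on the underlying algebra elements.                          *)
Definition ncpoly := seq (rat * word).

Definition pscale (a : rat) (p : ncpoly) : ncpoly := [seq (a * t.1, t.2) | t <- p].
Definition pone : ncpoly := [:: (1, [::])].
Definition pword (w : word) : ncpoly := [:: (1, w)].
Definition pmul (p q : ncpoly) : ncpoly :=
  [seq (t.1 * u.1, t.2 ++ u.2) | t <- p, u <- q].
Definition plin (f : word -> ncpoly) (p : ncpoly) : ncpoly :=
  flatten [seq pscale t.1 (f t.2) | t <- p].
Definition plinw (f : word -> word) (p : ncpoly) : ncpoly :=
  [seq (t.1, f t.2) | t <- p].

Definition delta (s : C) : rat := if (s == 0) || (s == 1) then 0 else 1.

(* z_{k,s} decomposition: a word is uniquely z_{k1,s1} ... z_{kn,sn} x^l.   *)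
Fixpoint zdec_aux (c : nat) (w : word) : seq (nat * C) * nat :=
  match w with
  | [::] => ([::], c)
  | Lx :: w' => zdec_aux c.+1 w'
  | Ly s :: w' => let: (zs, l) := zdec_aux 0 w' in ((c.+1, s) :: zs, l)
  end.
Definition zdec (w : word) : seq (nat * C) * nat := zdec_aux 0 w.

Definition zlet (ks : nat * C) : word := rcons (nseq ks.1.-1 Lx) (Ly ks.2).
Definition zcomp (zs : seq (nat * C)) (l : nat) : word :=
  flatten (map zlet zs) ++ nseq l Lx.

Fixpoint Iz (acc : C) (zs : seq (nat * C)) : seq (nat * C) :=
  if zs is ks :: zs' then (ks.1, acc * ks.2) :: Iz (acc * ks.2) zs' else [::].
Definition Iw (w : word) : word := let: (zs, l) := zdec w in zcomp (Iz 1 zs) l.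

Fixpoint Iinvz (prev : C) (zs : seq (nat * C)) : seq (nat * C) :=
  if zs is ks :: zs' then (ks.1, ks.2 / prev) :: Iinvz ks.2 zs' else [::].
Definition Iinvw (w : word) : word := let: (zs, l) := zdec w in zcomp (Iinvz 1 zs) l.

Definition Mw (s : C) (w : word) : word :=
  let: (zs, l) := zdec w in
  zcomp (if zs is ks :: zs' then (ks.1, s * ks.2) :: zs' else [::]) l.

Definition I_ (p : ncpoly) := plinw Iw p.
Definition Iinv (p : ncpoly) := plinw Iinvw p.
Definition M_ (s : C) (p : ncpoly) := plinw (Mw s) p.

Definition phi_letter (a : letter) : ncpoly :=
  match a with
  | Lx => [:: (1, [:: Lx]); (1, [:: Ly 1])]
  | Ly s => [:: (delta s, [:: Ly s]); (-1, [:: Ly 1])]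
  end.
Definition phi_word (w : word) : ncpoly := foldr (fun a acc => pmul (phi_letter a) acc) pone w.
Definition phi (p : ncpoly) : ncpoly := plin phi_word p.

Definition Lmul (u v : ncpoly) : ncpoly := pmul u v.
Definition x_plus_dy (s : C) : ncpoly := [:: (1, [:: Lx]); (delta s, [:: Ly s])].
Definition px : ncpoly := pword [:: Lx].

(* L_x^{-1}: removes a leading x (only applied to elements of x A; words not *)
(* starting with x, which never occur there, are sent to 0).                 *)
Definition Lxinv_word (w : word) : ncpoly :=
  if w is Lx :: w' then pword w' else [::].
Definition Lxinv (p : ncpoly) : ncpoly := plin Lxinv_word p.

Definition zpoly := seq (rat * seq (nat * C)).
Definition zcons (a : nat * C) (p : zpoly) : zpoly := [seq (t.1, a :: t.2) | t <- p].

Fixpoint harmz (u : seq (nat * C)) : seq (nat * C) -> zpoly :=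
  match u with
  | [::] => fun v => [:: (1, v)]
  | a :: u' =>
      fix harm_u (v : seq (nat * C)) : zpoly :=
        match v with
        | [::] => [:: (1, u)]
        | b :: v' => zcons a (harmz u' v) ++ zcons b (harm_u v')
                       ++ zcons ((a.1 + b.1)%N, a.2 * b.2) (harmz u' v')
        end
  end.

Definition dotharmz (u v : seq (nat * C)) : zpoly :=
  match u, v with
  | [::], _ => [:: (1, v)]
  | _, [::] => [:: (1, u)]
  | a :: u', b :: v' => zcons ((a.1 + b.1)%N, a.2 * b.2) (harmz u' v')
  end.

(* words of A^1 end with some y_s, so their trailing x-power is 0 *)
Definition zpoly_to_ncpoly (p : zpoly) : ncpoly := [seq (t.1, zcomp t.2 0) | t <- p].

Definition lift_prod (f : seq (nat * C) -> seq (nat * C) -> zpoly) (p q : ncpoly) : ncpoly :=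
  flatten [seq pscale (t.1 * u.1) (zpoly_to_ncpoly (f (zdec t.2).1 (zdec u.2).1))
          | t <- p, u <- q].

Definition harm (p q : ncpoly) : ncpoly := lift_prod harmz p q.
Definition dotharm (p q : ncpoly) : ncpoly := lift_prod dotharmz p q.

Definition y1pow (k : nat) : ncpoly := pword (nseq k (Ly 1)).

(* Multiple L-values of shuffle type.                                        *)
(* Gsum zs s' m' = sum_{m' > m_1 > ... > m_n > 0}                             *)
(*        s'^(m'-m_1) * prod_i s_i^(m_i - m_{i+1}) / m_i^(k_i)   (m_{n+1}=0)  *)
(* so that Gsum zs 1 M is the M-th partial sum of the defining series.       *)
Fixpoint Gsum (zs : seq (nat * C)) (s' : C) (m' : nat) : C :=
  match zs with
  | [::] => s' ^+ m'
  | ks :: zs' =>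
      \sum_(1 <= m < m') s' ^+ (m' - m)%N * ((m%:R ^+ ks.1)^-1 * Gsum zs' ks.2 m)
  end.

(* L^sh on a word x^{k1-1} y_{s1} ... x^{kn-1} y_{sn}: the limit as M -> oo  *)
(* of the partial sums (for the empty word the sequence is constantly 1).    *)
Definition Lsh_word (w : word) : C := lim ((fun M : nat => Gsum (zdec w).1 1 M) @ \oo).

Definition Lsh (p : ncpoly) : C := \sum_(t <- p) ratr t.1 * Lsh_word t.2.

Definition in_mu (r : nat) (s : C) : Prop := s ^+ r = 1.
Definition letter_in_mu (r : nat) (a : letter) : Prop :=
  match a with Lx => True | Ly s => in_mu r s end.
Definition letter_in_one (a : letter) : Prop :=
  match a with Lx => True | Ly s => s = 1 end.
Definition ends_with_y (w : word) : Prop :=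
  exists w' s, w = rcons w' (Ly s).

Definition in_A1pos_mu (r : nat) (p : ncpoly) : Prop :=
  List.Forall (fun t => ends_with_y t.2 /\ List.Forall (letter_in_mu r) t.2) p.
Definition in_A1pos_one (p : ncpoly) : Prop :=
  List.Forall (fun t => ends_with_y t.2 /\ List.Forall letter_in_one t.2) p.

Definition term1 (s : C) (w : ncpoly) (k : nat) : ncpoly :=
  Lxinv (I_ (dotharm (Iinv (Lmul (x_plus_dy s) (phi (I_ (M_ s w))))) (y1pow k.+1))).
Definition term2 (w' : ncpoly) (l : nat) : ncpoly :=
  Lxinv (dotharm (Lmul px (phi w')) (y1pow l)).

End FreeAlgebra.

(* Main.v *)
Require Import Defs.
From mathcomp Require Import all_boot all_order all_algebra all_classical all_reals all_analysis.
From mathcomp Require Import complex ring lra zify.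
Import numFieldNormedType.Exports.
Import Order.TTheory GRing.Theory Num.Theory Normc.
Set Implicit Arguments.
Unset Strict Implicit.
Unset Printing Implicit Defensive.
Local Open Scope ring_scope.

(** Put [pi_n(z) = prod_(1 <= j < n) (1 - z / j) = sum_k (-z)^k e_k(n)], and let
[p_n(w)] be the [n]-th coefficient of the multiple polylogarithm of the word
polynomial [(x + delta(s) y_s) phi I M_s w].  The values [L^sh(term1 s w k)] are
[sum_n p_n(w) e_k(n)], that is, up to sign, the Taylor coefficients at [z = 0] of the
Newton series [F_w(z) = sum_n p_n(w) pi_n(z)]; those of [term2] come in the same
way from a Newton series [K_w'(z)].  As [phi] encodes the substitution [t / (t - 1)],
at a positive integer [N] both series are finite nested sums:
[- N F_w(N)] is a harmonic sum in which every root of unity [s != 1] has become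
[1 - s], and [K_w'(N)] is the truncated multiple harmonic sum of [w'].  The
quasi-shuffle product then gives [F_(w * w')(N) = F_w(N) K_w'(N)].

To pass to [0 < z < 1], note that truncated Newton series are interpolation
polynomials.  Interpolating the product at [1, ..., B] differs from the product of the
interpolants by at most [(sum_(n <= B) |p_n|) V_B pi_(B+1)(z)], where [V_B] is the
Hausdorff variation of [K_w'].  The first two factors grow like powers of [log B]
while [pi_(B+1)(z)] decays like [B^(-z)], so [F_(w * w') = F_w K_w'] near [0+], and
comparing the coefficients of [z^m] gives the relation.  The series [sum_n p_n e_k(n)]
may converge only conditionally; summation by parts controls them. *)

(** * Convergence of complex sequences *)

Lemma cvg_regularD (K : numFieldType) (u v : nat -> K^o) (a b : K^o) :
  (u @ \oo --> a)%classic -> (v @ \oo --> b)%classic ->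
  ((fun n => u n + v n) @ \oo --> a + b)%classic.
Proof. exact: cvgD. Qed.

Lemma cvg_regularM (K : numFieldType) (u v : nat -> K^o) (a b : K^o) :
  (u @ \oo --> a)%classic -> (v @ \oo --> b)%classic ->
  ((fun n => u n * v n) @ \oo --> a * b)%classic.
Proof. exact: cvgM. Qed.

Section ComplexNorm.
Variable R : realType.
Local Notation C := (Cplx R).

Definition cnorm (x : C) : R := normc (x : R[i]).

Lemma cnorm_ge0 (x : C) : 0 <= cnorm x.
Proof. by case: x => a b; rewrite /cnorm /= sqrtr_ge0. Qed.

Lemma cnorm0 : cnorm 0 = 0. Proof. exact: normc0. Qed.
Lemma cnorm1 : cnorm 1 = 1. Proof. exact: normc1. Qed.
Lemma cnormM (x y : C) : cnorm (x * y) = cnorm x * cnorm y. Proof. exact: normcM. Qed.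
Lemma cnormN (x : C) : cnorm (- x) = cnorm x. Proof. exact: normcN. Qed.
Lemma cnormV (x : C) : cnorm x^-1 = (cnorm x)^-1. Proof. exact: normcV. Qed.
Lemma cnormD (x y : C) : cnorm (x + y) <= cnorm x + cnorm y. Proof. exact: le_normcD. Qed.
Lemma cnormB (x y : C) : cnorm (x - y) <= cnorm x + cnorm y.
Proof. by rewrite -[cnorm y]cnormN; exact: cnormD. Qed.
Lemma cnorm_eq0 (x : C) : (cnorm x == 0) = (x == 0).
Proof. by apply/eqP/eqP => [/eq0_normc//|->]; rewrite cnorm0. Qed.
Lemma cnormX (x : C) n : cnorm (x ^+ n) = cnorm x ^+ n.
Proof. by elim: n => [|n IH]; rewrite ?expr0 ?cnorm1 // !exprS cnormM IH. Qed.
Lemma cnorm_real (x : R) : cnorm (real_complex R x) = `|x|.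
Proof. by rewrite /cnorm /= expr0n addr0 sqrtr_sqr. Qed.
Lemma real_complex_nat n : real_complex R n%:R = n%:R.
Proof. by rewrite rmorph_nat. Qed.
Lemma cnorm_nat n : cnorm n%:R = n%:R.
Proof. by rewrite -real_complex_nat cnorm_real normr_nat. Qed.
Lemma cnorm_sum I (r : seq I) (P : pred I) (F : I -> C) :
  cnorm (\sum_(i <- r | P i) F i) <= \sum_(i <- r | P i) cnorm (F i).
Proof.
elim/big_rec2: _ => [|i y x _ H]; first by rewrite cnorm0.
by apply: le_trans (cnormD _ _) _; rewrite lerD2l.
Qed.

(** The norm of [R[i]] takes its values in [R[i]]; this passes to radii in [R], as a positive
    complex number is real. *)
Lemma cvg_cnormP (u : nat -> C) (l : C) :
  (forall e : R, 0 < e -> exists N, forall n, (N <= n)%N -> cnorm (l - u n) < e) <->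
  (u @ \oo --> l)%classic.
Proof.
split=> [H|H e e0].
  apply/cvgrPdist_lt => e e0.
  have er : e = real_complex R (complex.Re e).
    by rewrite RRe_real // gtr0_real.
  have e0' : 0 < complex.Re e by rewrite -ltcR -er.
  have [N HN] := H _ e0'.
  exists N => //= n /= Nn.
  rewrite er; have := HN _ Nn; rewrite -ltcR; exact.
have e0' : 0 < real_complex R e by rewrite ltcR.
have /cvgrPdist_lt/(_ _ e0')[N _ HN] := H.
exists N => n Nn; rewrite -ltcR; exact: HN.
Qed.

Lemma cnorm_cvg_le (u : nat -> C) (l : C) (c : R) (N : nat) :
  (u @ \oo --> l)%classic -> (forall n, (N <= n)%N -> cnorm (u n) <= c) -> cnorm l <= c.
Proof.
move=> /cvg_cnormP ul uc; rewrite leNgt; apply/negP => cl.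
have e0 : 0 < cnorm l - c by rewrite subr_gt0.
have [N' HN] := ul _ e0; pose n := maxn N N'.
have := HN n (leq_maxr _ _); apply/negP; rewrite -leNgt lerBlDr.
have := cnormD (l - u n) (u n); rewrite subrK => H.
by apply: (le_trans H); rewrite lerD2l uc // leq_maxl.
Qed.

Lemma cnorm_Re (x : C) : `|complex.Re x| <= cnorm x.
Proof.
case: x => a b; rewrite /cnorm /= -[leLHS]sqrtr_sqr ?ler_sqrt ?addr_ge0 ?sqr_ge0 //.
by rewrite lerDl sqr_ge0.
Qed.

Lemma cnorm_Im (x : C) : `|complex.Im x| <= cnorm x.
Proof.
case: x => a b; rewrite /cnorm /= -[leLHS]sqrtr_sqr ?ler_sqrt ?addr_ge0 ?sqr_ge0 //.
by rewrite lerDr sqr_ge0.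
Qed.

Lemma cnorm_le_ReIm (x : C) : cnorm x <= `|complex.Re x| + `|complex.Im x|.
Proof.
rewrite {1}(complexE (x : R[i])); apply: le_trans (cnormD _ _) _.
rewrite cnormM !cnorm_real lerD2l [X in X * _](_ : _ = 1) ?mul1r //.
by rewrite /cnorm /= expr0n expr1n add0r sqrtr1.
Qed.

Lemma cvg_ReIm (u : nat -> C) (a b : R) :
  ((fun n => complex.Re (u n)) @ \oo --> a)%classic ->
  ((fun n => complex.Im (u n)) @ \oo --> b)%classic ->
  (u @ \oo --> (Complex a b : C))%classic.
Proof.
move=> /cvgrPdist_lt ua /cvgrPdist_lt ub; apply/cvg_cnormP => e e0.
have e2 : 0 < e / 2 by rewrite divr_gt0.
have [N1 _ H1] := ua _ e2; have [N2 _ H2] := ub _ e2.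
exists (maxn N1 N2) => n; rewrite geq_max => /andP[n1 n2].
apply: (le_lt_trans (cnorm_le_ReIm _)).
have := ltrD (H1 _ n1) (H2 _ n2).
rewrite -splitr; apply: le_lt_trans.
by case: (u n).
Qed.

Lemma cvg_bounded_series (a : nat -> R) (M : R) :
  (forall B, \sum_(0 <= i < B) `|a i| <= M) ->
  (cvg ((fun B => \sum_(0 <= i < B) a i) @ \oo))%classic.
Proof.
move=> H; apply: (@normed_cvg _ R^o a).
have -> : [normed series (a : R^o ^nat)] = (fun B => \sum_(0 <= i < B) `|a i|) by [].
apply: nondecreasing_is_cvgn.
  by apply/nondecreasing_seqP => n; rewrite big_nat_recr //= lerDl.
by exists M => _ [n _ <-]; exact: H.
Qed.

Lemma cvg_bounded_cnorm_series (a : nat -> C) (M : R) :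
  (forall B, \sum_(0 <= i < B) cnorm (a i) <= M) ->
  exists l : C, ((fun B => \sum_(0 <= i < B) a i) @ \oo --> l)%classic.
Proof.
move=> H.
have Hre : forall B, complex.Re (\sum_(0 <= i < B) a i : R[i]) =
   \sum_(0 <= i < B) complex.Re (a i).
  by move=> B; apply: (big_morph (fun x : R[i] => complex.Re x)) => // -[? ?] [? ?].
have Him : forall B, complex.Im (\sum_(0 <= i < B) a i : R[i]) =
   \sum_(0 <= i < B) complex.Im (a i).
  by move=> B; apply: (big_morph (fun x : R[i] => complex.Im x)) => // -[? ?] [? ?].
have /cvg_ex[/= l1 c1] := @cvg_bounded_series (fun i => complex.Re (a i)) M
   (fun B => le_trans (ler_sum _ (fun i _ => cnorm_Re (a i))) (H B)).
have /cvg_ex[/= l2 c2] := @cvg_bounded_series (fun i => complex.Im (a i)) M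
   (fun B => le_trans (ler_sum _ (fun i _ => cnorm_Im (a i))) (H B)).
exists (Complex l1 l2); apply: cvg_ReIm.
  by under eq_fun do rewrite Hre.
by under eq_fun do rewrite Him.
Qed.

Lemma cvgCD (u v : nat -> C) (a b : C) : (u @ \oo --> a)%classic ->
  (v @ \oo --> b)%classic -> ((fun n => u n + v n) @ \oo --> a + b)%classic.
Proof. exact: (@cvg_regularD R[i]). Qed.

Lemma cvgCM (u v : nat -> C) (a b : C) : (u @ \oo --> a)%classic ->
  (v @ \oo --> b)%classic -> ((fun n => u n * v n) @ \oo --> a * b)%classic.
Proof. exact: (@cvg_regularM R[i]). Qed.

Lemma cvgC_cst (a : C) : ((fun _ : nat => a) @ \oo --> a)%classic.
Proof. exact: (@cvg_cst (Cplx R)). Qed.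

Lemma cvgC_sum I (r : seq I) (f : I -> nat -> C) (l : I -> C) :
  List.Forall (fun i => (f i @ \oo --> l i)%classic) r ->
  ((fun n => \sum_(i <- r) f i n) @ \oo --> \sum_(i <- r) l i)%classic.
Proof.
elim: r => [|i r IH] H.
  by under eq_fun do rewrite big_nil; rewrite big_nil; exact: cvgC_cst.
under eq_fun do rewrite big_cons; rewrite big_cons.
have h1 := List.Forall_inv H; have h2 := List.Forall_inv_tail H.
exact: (cvgCD h1 (IH h2)).
Qed.

Lemma limC (u : nat -> C) (l : C) : (u @ \oo --> l)%classic -> lim (u @ \oo)%classic = l.
Proof. by move=> ul; apply: (cvg_lim _ ul); exact: norm_hausdorff. Qed.

End ComplexNorm.

(** * Logarithmic growth *)

Section Growth.
Variable R : realType.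
Implicit Types (n c B : nat).

(** The harmonic number, a stand-in for the logarithm. The added 1 keeps it at least 1, so its
    powers increase with the exponent and never vanish. *)
Definition hnum n : R := 1 + \sum_(0 <= j < n) j.+1%:R^-1.

Lemma hnumS n : hnum n.+1 = hnum n + n.+1%:R^-1.
Proof. by rewrite /hnum big_nat_recr //= addrA. Qed.

Lemma hnum_ge1 n : 1 <= hnum n.
Proof. by rewrite /hnum lerDl sumr_ge0. Qed.

Lemma hnum_ge0 n : 0 <= hnum n.
Proof. exact: le_trans ler01 (hnum_ge1 n). Qed.

Lemma hnum_mono m n : (m <= n)%N -> hnum m <= hnum n.
Proof.
elim: n => [|n IH]; first by rewrite leqn0 => /eqP ->.
rewrite leq_eqVlt ltnS => /orP[/eqP->//|/IH H].
by rewrite hnumS; apply: le_trans H _; rewrite lerDl.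
Qed.

Lemma hnum_le2 n : hnum n.+1 <= 2 * hnum n.
Proof.
rewrite hnumS; rewrite mulr2n mulrDl mul1r lerD2l (le_trans _ (hnum_ge1 n)) //.
by rewrite invf_le1 // ler1n.
Qed.

Lemma hnumX_mono c m n : (m <= n)%N -> hnum m ^+ c <= hnum n ^+ c.
Proof. by move=> mn; rewrite lerXn2r ?nnegrE ?hnum_ge0 ?hnum_mono. Qed.

Lemma hnumX_ge0 c n : 0 <= hnum n ^+ c.
Proof. by rewrite exprn_ge0 ?hnum_ge0. Qed.

Lemma hnumX_le c d n : (c <= d)%N -> hnum n ^+ c <= hnum n ^+ d.
Proof. by move=> cd; rewrite ler_weXn2l ?hnum_ge1. Qed.

Lemma hnumX_le2 c n : hnum n.+1 ^+ c <= 2 ^+ c * hnum n ^+ c.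
Proof.
by rewrite -exprMn lerXn2r ?nnegrE ?mulr_ge0 ?hnum_ge0 // hnum_le2.
Qed.

(** Discrete mean value estimate: the difference of powers factors as the increment times [c.+1]
    products, each at most [hnum n.+1 ^+ c]. *)
Lemma hnumXS_sub c n : hnum n.+1 ^+ c.+1 - hnum n ^+ c.+1 <= c.+1%:R * hnum n.+1 ^+ c / n.+1%:R.
Proof.
rewrite subrXX hnumS [X in X * _](_ : _ = n.+1%:R^-1); last by rewrite addrC addKr.
rewrite -hnumS mulrC ler_pM2r ?invr_gt0 ?ltr0n //.
have -> : c.+1%:R * hnum n.+1 ^+ c = \sum_(i < c.+1) hnum n.+1 ^+ c.
  by rewrite sumr_const card_ord mulr_natl.
apply: ler_sum => i _.
have -> : hnum n.+1 ^+ c = hnum n.+1 ^+ (c.+1.-1 - i) * hnum n.+1 ^+ i.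
  by rewrite -exprD subnK //= -ltnS ltn_ord.
by rewrite ler_wpM2l ?hnumX_ge0 // hnumX_mono.
Qed.

Lemma hnumX_linear c : exists2 M : R, 0 <= M & forall n, hnum n ^+ c <= M * n.+1%:R.
Proof.
elim: c => [|c [M M0 IH]].
  by exists 1 => // n; rewrite expr0 mul1r ler1n.
(* The 1 covers [n = 0]; the other summand bounds each increment, with the 2 absorbing
   [n.+2 <= 2 * n.+1]. *)
exists (1 + c.+1%:R * (2 * M)) => [|n].
  by rewrite addr_ge0 // !mulr_ge0.
elim: n => [|n IHn].
  by rewrite /hnum big_geq // addr0 expr1n mulr1 lerDl !mulr_ge0.
have H := hnumXS_sub c n.
have H2 : c.+1%:R * hnum n.+1 ^+ c / n.+1%:R <= c.+1%:R * (2 * M).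
  rewrite ler_pdivrMr ?ltr0n // -mulrA ler_wpM2l //.
  apply: le_trans (IH _) _.
  rewrite [2 * M]mulrC -mulrA ler_wpM2l // -natrM ler_nat; lia.
rewrite -[n.+2]addn1 natrD mulrDr mulr1.
rewrite -(subrK (hnum n ^+ c.+1) (hnum n.+1 ^+ c.+1)) addrC lerD //.
by apply: le_trans (le_trans H H2) _; rewrite lerDr.
Qed.

(** Summation by parts against a telescoping majorant of [1 / n ^ 2] replaces the power of [hnum] by
    its increments, which lowers the exponent by one and allows induction on [c]. *)
Lemma sum_hnumX_sqr c : exists2 M : R, 0 <= M &
  forall B, \sum_(1 <= n < B) hnum n ^+ c / n%:R ^+ 2 <= M.
Proof.
suff H : exists2 M : R, 0 <= M & forall B, \sum_(0 <= n < B) hnum n.+1 ^+ c / n.+1%:R ^+ 2 <= M.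
  have [M M0 HM] := H; exists M => // -[|B]; first by rewrite big_geq.
  by rewrite big_add1 /=.
have tu n : (n.+1%:R ^+ 2)^-1 <= 2 * (n.+1%:R^-1 - n.+2%:R^-1) :> R.
  have a1 : 1 <= n.+1%:R :> R by rewrite ler1n.
  rewrite -[n.+2%:R]natr1; set a := n.+1%:R : R in a1 *.
  have -> : a^-1 - (a + 1)^-1 = (a * (a + 1))^-1 by field; apply/andP; split; lra.
  have p : 0 < a * (a + 1) by rewrite mulr_gt0; lra.
  by rewrite ler_pdivlMr // ler_pdivrMl ?exprn_gt0 //; nra.
have step c' B : \sum_(0 <= n < B) hnum n.+1 ^+ c' / n.+1%:R ^+ 2 <=
   2 * (1 - hnum B ^+ c' / B.+1%:R) +
   2 * \sum_(0 <= n < B) (hnum n.+1 ^+ c' - hnum n ^+ c') / n.+1%:R.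
  elim: B => [|B IHB].
    by rewrite !big_geq // /hnum big_geq // addr0 expr1n divr1 subrr !mulr0 addr0.
  rewrite !big_nat_recr //=.
  have := ler_wpM2l (hnumX_ge0 c' B.+1) (tu B).
  move: IHB; move: (hnum B.+1 ^+ c') (hnum B ^+ c') (B.+1%:R ^- 2) (B.+1%:R^-1) => x y q t.
  by move: (\sum_(_ <= _ < _) _) (\sum_(_ <= _ < _) _) (B.+2%:R^-1) => *; lra.
elim: c => [|c [M M0 IH]].
  exists 2 => // B; apply: le_trans (step 0%N B) _.
  rewrite big1 ?mulr0 ?addr0 => [|i _]; last by rewrite !expr0 subrr mul0r.
  by rewrite ler_piMr // gerBl divr_ge0 // hnumX_ge0.
exists (2 + 2 * (c.+1%:R * M)) => [|B]; first by rewrite addr_ge0 // !mulr_ge0.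
apply: le_trans (step c.+1 B) _; apply: lerD.
  by rewrite ler_piMr // gerBl divr_ge0 // hnumX_ge0.
rewrite ler_wpM2l //; apply: le_trans (_ : c.+1%:R * \sum_(0 <=
  n < B) hnum n.+1 ^+ c / n.+1%:R ^+ 2 <= _).
  rewrite mulr_sumr; apply: ler_sum => n _.
  rewrite ler_pdivrMr ?ltr0n //; apply: le_trans (hnumXS_sub c n) _.
  rewrite -!mulrA ler_wpM2l // ler_wpM2l ?hnumX_ge0 // expr2 invfM mulrAC -mulrA.
  by rewrite mulfV ?mulr1 // pnatr_eq0.
by rewrite ler_wpM2l.
Qed.

Lemma hnum_unbounded A : exists N, forall n, (N <= n)%N -> A <= hnum n.
Proof.
suff [N HN] : exists N, A <= hnum N.
  by exists N => n /hnum_mono; exact: le_trans.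
apply: contrapT => /forallNP H.
apply: (@dvg_harmonic R); apply: nondecreasing_is_cvgn.
  by apply/nondecreasing_seqP => n; rewrite !seriesEnat /= big_nat_recr //= lerDl.
exists A => _ [n _ <-]; rewrite /series /=.
have /negP := H n; rewrite -ltNge => /ltW; apply: le_trans.
by rewrite /hnum lerDr.
Qed.

Definition fall_prodR n (z : R) : R := \prod_(1 <= j < n) (1 - z / j%:R).

Lemma fall_prodRS n z : fall_prodR n.+2 z = fall_prodR n.+1 z * (1 - z / n.+1%:R).
Proof. by rewrite /fall_prodR big_nat_recr. Qed.

Lemma factor_bounds j (z : R) : 0 <= z <= 1 -> 0 <= 1 - z / j.+1%:R <= 1.
Proof.
move=> /andP[z0 z1]; rewrite subr_ge0 gerBl divr_ge0 // andbT.
by rewrite ler_pdivrMr ?ltr0n // mul1r (le_trans z1) // ler1n.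
Qed.

Lemma fall_prodR_bounds n (z : R) : 0 <= z <= 1 -> 0 <= fall_prodR n z <= 1.
Proof.
move=> zb; rewrite /fall_prodR; case: n => [|n]; first by rewrite big_geq // ler01 lexx.
rewrite big_add1 /= prodr_ge0 /=.
  elim/big_rec: _ => // i x _ H; have /andP[a b] := factor_bounds i zb.
  by apply: le_trans (ler_wpM2l a H) _; rewrite mulr1.
by move=> i _; have /andP[] := factor_bounds i zb.
Qed.

Lemma fall_prodR_exp n (z : R) : 0 <= z <= 1 -> fall_prodR n.+1 z <= expR (- (z * (hnum n - 1))).
Proof.
move=> zb; elim: n => [|n IH].
  by rewrite /fall_prodR big_geq // /hnum big_geq // addr0 subrr mulr0 oppr0 expR0.
rewrite fall_prodRS hnumS.
have -> : - (z * (hnum n + n.+1%:R^-1 - 1)) = - (z * (hnum n - 1)) + (- (z / n.+1%:R)) by ring.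
rewrite expRD; apply: ler_pM => //.
- by have /andP[] := fall_prodR_bounds n.+1 zb.
- by have /andP[] := factor_bounds n zb.
- exact: expR_ge1Dx.
Qed.

Lemma hnumX_fall_prodR_cvg0 c (z e : R) : 0 < z < 1 -> 0 < e ->
  exists N, forall n, (N <= n)%N -> hnum n ^+ c * fall_prodR n.+1 z < e.
Proof.
move=> /andP[z0 z1] e0.
have zb : 0 <= z <= 1 by rewrite !ltW.
(* From [exp y >= y ^ (c+1) / (c+1)!] at [y = z * (hnum n - 1)]; the power of 2 comes from
   [hnum n - 1 >= hnum n / 2], valid once [hnum n >= 2]. *)
pose D : R := c.+1`!%:R * 2 ^+ c.+1 / z ^+ c.+1.
have D0 : 0 < D by rewrite !mulr_gt0 ?invr_gt0 ?exprn_gt0 ?ltr0n ?fact_gt0.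
have [N HN] := hnum_unbounded (Num.max 2 (2 * D / e)).
exists N => n /HN; rewrite ge_max => /andP[h2 hD].
have h0 : 0 < hnum n by apply: lt_le_trans ltr01 (hnum_ge1 n).
have k1 : fall_prodR n.+1 z <= D / hnum n ^+ c.+1.
  apply: le_trans (fall_prodR_exp n zb) _.
  rewrite expRN ler_pdivlMr ?exprn_gt0 // mulrC ler_pdivrMr ?expR_gt0 //.
  have x0 : 0 <= z * (hnum n - 1) by rewrite mulr_ge0 ?ltW // subr_gt0; lra.
  have /(le_trans _) := expR_ge1Dxn c x0.
  move=> /(_ (( z * (hnum n - 1)) ^+ c.+1 / c.+1`!%:R)).
  rewrite lerDr ler01 => /(_ isT) H.
  have := ler_wpM2l (ltW D0) H; apply: le_trans.
  rewrite /D; set f := c.+1`!%:R.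
  have f0 : f != 0 by rewrite pnatr_eq0 -lt0n fact_gt0.
  rewrite exprMn.
  have -> : f * 2 ^+ c.+1 / z ^+ c.+1 * (z ^+ c.+1 * (hnum n - 1) ^+ c.+1 / f)
     = (2 * (hnum n - 1)) ^+ c.+1.
    by rewrite exprMn; field; rewrite expf_neq0 ?gt_eqF.
  rewrite lerXn2r // ?nnegrE; lra.
apply: le_lt_trans (ler_wpM2l (hnumX_ge0 c n) k1) _.
have -> : hnum n ^+ c * (D / hnum n ^+ c.+1) = D / hnum n.
  by rewrite exprS; field; rewrite gt_eqF //= expf_neq0 // gt_eqF.
rewrite ltr_pdivrMr // -ltr_pdivrMl // mulrC (lt_le_trans _ hD) //.
by rewrite ltr_pM2r ?invr_gt0 // mulrDl mul1r ltrDl.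
Qed.

End Growth.

(** * Conditionally convergent series *)

Section Oscillation.
Variable R : realType.
Local Notation C := (Cplx R).
Local Notation hnum := (hnum R).
Implicit Types (th : C) (X Y rho : nat -> C) (n c d B k m : nat) (M A : R).

Lemma cvgC_shift (u : nat -> C) (l : C) :
  ((fun n => u n.+1) @ \oo --> l)%classic -> (u @ \oo --> l)%classic.
Proof.
move=> /cvg_cnormP H; apply/cvg_cnormP => e /H[N HN].
by exists N.+1 => -[//|n] /HN.
Qed.

Lemma hnumX_div_le c : exists2 L : R, 0 <= L & forall n, (0 < n)%N -> hnum n ^+ c / n%:R <= L.
Proof.
have [L L0 HL] := hnumX_linear R c; exists (2 * L) => [|n n0]; first by rewrite mulr_ge0.
rewrite ler_pdivrMr ?ltr0n //; apply: le_trans (HL n) _.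
by rewrite [2 * L]mulrC -mulrA ler_wpM2l // -natrM ler_nat; lia.
Qed.

Lemma hnumX_div_cvg0 c (e : R) : 0 < e ->
  exists N, forall n, (N <= n)%N -> (0 < n)%N -> hnum n ^+ c / n%:R < e.
Proof.
move=> e0; have [L L0 HL] := hnumX_div_le c.+1.
have [N HN] := hnum_unbounded ((L + 1) / e).
exists N => n /HN Hn n0; have h0 : 0 < hnum n by apply: lt_le_trans ltr01 (hnum_ge1 R n).
move: Hn; rewrite ler_pdivrMr // => Hn.
have := HL _ n0; rewrite exprS -mulrA => H.
rewrite -(ltr_pM2l h0); lra.
Qed.

(* For coefficients [t^n g(n) / n^a] with [g] of logarithmic growth, [th = t] if [a = 1]
and [th = 0] if [a >= 2]; when [th != 1], multiplying the series by [1 - th] makes it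
absolutely convergent. *)
Definition oscillating th c M X := forall n, (0 < n)%N ->
  cnorm (X n) <= M * (hnum n ^+ c / n%:R) /\
  cnorm (X n.+1 - th * X n) <= M * (hnum n ^+ c / n%:R ^+ 2).

(** Summation by parts: multiplying by [1 - th] trades the terms for twisted differences and two
    boundary terms. *)
Lemma osc_telescope th X B :
  (1 - th) * \sum_(1 <= n < B.+2) X n =
  X 1%N + \sum_(1 <= n < B.+1) (X n.+1 - th * X n) - th * X B.+1.
Proof.
elim: B => [|B IH]; first by rewrite big_nat1 big_geq // addr0 mulrBl mul1r.
by rewrite big_nat_recr //= mulrDr IH [in RHS]big_nat_recr //=; ring.
Qed.

(** All three parts of [osc_telescope] are bounded. The constant depends on [th] and [c] only, which
    later gives uniformity in the variable of the Newton series. *)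
Lemma osc_sum_bounded th c : th != 1 -> exists2 A : R, 0 <= A &
  forall X M, 0 <= M -> oscillating th c M X -> forall B, cnorm (\sum_(1 <= n < B) X n) <= A * M.
Proof.
move=> th1; have [L L0 HL] := hnumX_div_le c; have [S S0 HS] := sum_hnumX_sqr R c.
have d0 : 0 < cnorm (1 - th).
  by rewrite lt_def cnorm_ge0 cnorm_eq0 subr_eq0 eq_sym th1.
exists ((L + S + cnorm th * L) / cnorm (1 - th)) => [|X M M0 HX B].
  by rewrite divr_ge0 ?addr_ge0 ?mulr_ge0 ?cnorm_ge0.
have XL n : (0 < n)%N -> cnorm (X n) <= L * M.
  move=> n0; apply: le_trans (HX _ n0).1 _.
  by rewrite mulrC ler_wpM2r // HL.
case: B => [|[|B]].
- by rewrite big_geq // cnorm0 mulr_ge0 // divr_ge0 ?addr_ge0 ?mulr_ge0 ?cnorm_ge0.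
- by rewrite big_geq // cnorm0 mulr_ge0 // divr_ge0 ?addr_ge0 ?mulr_ge0 ?cnorm_ge0.
rewrite mulrAC ler_pdivlMr // mulrC -cnormM osc_telescope.
apply: le_trans (cnormB _ _) _; rewrite 2!mulrDl; apply: lerD; last first.
  by rewrite cnormM -mulrA ler_wpM2l ?cnorm_ge0 // XL.
apply: le_trans (cnormD _ _) _; apply: lerD; first exact: XL.
apply: le_trans (cnorm_sum _ _ _) _.
apply: (@le_trans _ _ (\sum_(1 <= n < B.+1) M * (hnum n ^+ c / n%:R ^+ 2))).
  rewrite !big_nat; apply: ler_sum => n /andP[n0 _]; exact: (HX _ n0).2.
by rewrite -mulr_sumr mulrC ler_wpM2r.
Qed.

Lemma osc_sum_cvg th c M X : th != 1 -> 0 <= M -> oscillating th c M X ->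
  exists l : C, ((fun B => \sum_(1 <= n < B) X n) @ \oo --> l)%classic.
Proof.
move=> th1 M0 HX; have [S S0 HS] := sum_hnumX_sqr R c.
have [l Hl] : exists l : C,
   ((fun B => \sum_(0 <= n < B) (X n.+2 - th * X n.+1)) @ \oo --> l)%classic.
  apply: (@cvg_bounded_cnorm_series _ _ (M * S)) => B.
  apply: (@le_trans _ _ (\sum_(1 <= n < B.+1) M * (hnum n ^+ c / n%:R ^+ 2))).
    by rewrite big_add1 /=; apply: ler_sum => n _; exact: (HX n.+1 isT).2.
  by rewrite -mulr_sumr ler_wpM2l.
(* The limit is read off [osc_telescope]; the final 0 is the limit of the boundary term [X B.+1]. *)
exists ((1 - th)^-1 * (X 1%N + l + - th * 0)).
apply: cvgC_shift; apply: cvgC_shift.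
have -> : (fun B => \sum_(1 <= n < B.+2) X n) =
   (fun B => (1 - th)^-1 * (X 1%N + \sum_(0 <= n < B) (X n.+2 - th * X n.+1)
        + - th * X B.+1)).
  apply/funext => B; apply: (@mulfI _ (1 - th)).
    by rewrite subr_eq0 eq_sym.
  rewrite osc_telescope big_add1 /= mulNr mulVKf // subr_eq0 eq_sym //.
have X0 : ((fun B => X B.+1) @ \oo --> (0 : C))%classic; last first.
  have c1 := cvgCD (@cvgC_cst R (X 1%N)) Hl.
  have c3 := cvgCD c1 (cvgCM (@cvgC_cst R (- th)) X0).
  exact: (cvgCM (@cvgC_cst R ((1 - th)^-1)) c3).
apply/cvg_cnormP => e e0.
have M1 : 0 < M + 1 by rewrite ltr_wpDl.
have [N HN] := hnumX_div_cvg0 c (divr_gt0 e0 M1).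
exists N => n Nn; rewrite sub0r cnormN.
apply: le_lt_trans (HX n.+1 isT).1 _.
have := HN n.+1 (leqW Nn) isT; rewrite ltr_pdivlMr // => H.
apply: le_lt_trans H; rewrite mulrC ler_wpM2l ?lerDl //.
by rewrite divr_ge0 ?hnumX_ge0.
Qed.

Definition slowly_varying d M rho := forall n, (0 < n)%N ->
  cnorm (rho n) <= M * hnum n ^+ d /\ cnorm (rho n.+1 - rho n) <= M * (hnum n ^+ d / n%:R).

(** Discrete product rule for the twisted difference. In the constant, 1 serves the size bound,
    [2 ^+ d] the passage from [hnum n.+1] to [hnum n], and [cnorm th] the variation of [rho]. *)
Lemma osc_slow th c d M M' X rho : 0 <= M -> 0 <= M' ->
  oscillating th c M X -> slowly_varying d M' rho ->
  oscillating th (c + d) (M * (1 + 2 ^+ d + cnorm th) * M') (fun n => X n * rho n).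
Proof.
move=> M0 M'0 HX Hr n n0.
have [x1 x2] := HX _ n0; have [r1 r2] := Hr _ n0.
have [r3 _] := Hr n.+1 isT.
have nn : 0 <= n%:R^-1 :> R by rewrite invr_ge0.
have hc := hnumX_ge0 R c n; have hd := hnumX_ge0 R d n.
have K1 : 0 <= 1 + 2 ^+ d + cnorm th.
  by rewrite !addr_ge0 ?cnorm_ge0 // exprn_ge0.
split.
  rewrite cnormM; apply: (@le_trans _ _ ((M * (hnum n ^+ c / n%:R)) * (M' * hnum n ^+ d))).
    by apply: ler_pM; rewrite ?cnorm_ge0.
  have -> : M * (hnum n ^+ c / n%:R) * (M' * hnum n ^+ d) =
     1 * (M * M' * hnum n ^+ (c + d) / n%:R) by rewrite exprD; ring.
  have -> : M * (1 + 2 ^+ d + cnorm th) * M' * (hnum n ^+ (c + d) / n%:R) =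
     (1 + 2 ^+ d + cnorm th) * (M * M' * hnum n ^+ (c + d) / n%:R) by ring.
  apply: ler_wpM2r; first by rewrite !mulr_ge0 ?hnumX_ge0.
  by rewrite -addrA lerDl addr_ge0 ?cnorm_ge0 // exprn_ge0.
have -> : X n.+1 * rho n.+1 - th * (X n * rho n) =
   (X n.+1 - th * X n) * rho n.+1 + th * X n * (rho n.+1 - rho n) by ring.
apply: le_trans (cnormD _ _) _; rewrite !cnormM.
apply: (@le_trans _ _ ((M * (hnum n ^+ c / n%:R ^+ 2)) * (M' * (2 ^+ d * hnum n ^+ d)) +
   cnorm th * (M * (hnum n ^+ c / n%:R)) * (M' * (hnum n ^+ d / n%:R)))).
  apply: lerD.
    apply: ler_pM; rewrite ?cnorm_ge0 //.
    by apply: le_trans r3 _; rewrite ler_wpM2l // hnumX_le2.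
  apply: ler_pM; rewrite ?cnorm_ge0 ?mulr_ge0 ?cnorm_ge0 //.
  by rewrite ler_wpM2l ?cnorm_ge0.
have -> : (M * (hnum n ^+ c / n%:R ^+ 2)) * (M' * (2 ^+ d * hnum n ^+ d)) +
   cnorm th * (M * (hnum n ^+ c / n%:R)) * (M' * (hnum n ^+ d / n%:R)) =
   (2 ^+ d + cnorm th) * (M * M' * (hnum n ^+ (c + d) / n%:R ^+ 2)).
  by rewrite exprD expr2 invfM; ring.
have -> : M * (1 + 2 ^+ d + cnorm th) * M' * (hnum n ^+ (c + d) / n%:R ^+ 2) =
  (1 + 2 ^+ d + cnorm th) * (M * M' * (hnum n ^+ (c + d) / n%:R ^+ 2)) by ring.
apply: ler_wpM2r; first by rewrite !mulr_ge0 ?hnumX_ge0 ?invr_ge0 // exprn_ge0.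
by rewrite lerD2r lerDr.
Qed.

(** * Nested sums, falling products and their Taylor remainders *)

Lemma GsumS a v s n : (0 < n)%N ->
  @Gsum R (a :: v) s n.+1 = s * (Gsum (a :: v) s n + (n%:R ^+ a.1)^-1 * Gsum v a.2 n).
Proof.
move=> n0 /=; rewrite big_nat_recr //= subSnn expr1 mulrDr; congr (_ + _).
rewrite mulr_sumr !big_nat; apply: eq_bigr => i /andP[_ iN].
by rewrite mulrA -exprS subSn // ltnW.
Qed.

Lemma Gsum1 a v s : @Gsum R (a :: v) s 1 = 0.
Proof. by rewrite /= big_geq. Qed.

(** The elementary symmetric function [e_k] of [1, 1/2, ..., 1/(n-1)], written as a nested sum so
    that the quasi-shuffle product applies to it. *)
Definition elem_harm k n : C := Gsum (nseq k (1%N, 1)) 1 n.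

Lemma elem_harm0 n : elem_harm 0 n = 1.
Proof. by rewrite /elem_harm /= expr1n. Qed.

Lemma elem_harmS1 k : elem_harm k.+1 1 = 0.
Proof. exact: Gsum1. Qed.

Lemma elem_harmSS k n : (0 < n)%N ->
  elem_harm k.+1 n.+1 = elem_harm k.+1 n + elem_harm k n / n%:R.
Proof. by move=> n0; rewrite /elem_harm -[nseq k.+1 _]/(_ :: nseq k _) GsumS // mul1r expr1 [_
  / _]mulrC. Qed.

Lemma growth_step (a : R) k n :
  a <= hnum n ^+ k -> a / n.+1%:R + hnum n ^+ k.+1 <= hnum n.+1 ^+ k.+1.
Proof.
move=> ak; apply: (@le_trans _ _ (hnum n.+1 * hnum n ^+ k)).
  by rewrite hnumS mulrDl addrC exprS lerD2l mulrC ler_wpM2l ?invr_ge0.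
by rewrite exprS ler_wpM2l ?hnum_ge0 // hnumX_mono.
Qed.

Definition fall_prod n (z : C) : C := \prod_(1 <= j < n) (1 - z / j%:R).

Lemma fall_prodS n z : (0 < n)%N -> fall_prod n.+1 z = fall_prod n z * (1 - z / n%:R).
Proof. by move=> n0; rewrite /fall_prod big_nat_recr. Qed.

Lemma fall_prod1 z : fall_prod 1 z = 1.
Proof. by rewrite /fall_prod big_geq. Qed.

Lemma fall_prod_real n (x : R) : fall_prod n (real_complex R x) = real_complex R (fall_prodR n x).
Proof.
rewrite /fall_prod /fall_prodR; apply/esym; rewrite rmorph_prod; apply: eq_bigr => j _.
by rewrite rmorphB rmorph1 fmorph_div /= rmorph_nat.
Qed.

Definition taylor_rem m n (z : C) : C := fall_prod n z - \sum_(k < m) (- z) ^+ k * elem_harm k n.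

(** The falling product and its Taylor polynomial obey the same recursion in [n], except that
    multiplication by [z / n] costs one order of truncation. For [m = 0] the convention [0.-1 = 0]
    is right: nothing is subtracted. *)
Lemma taylor_rem_diff m n z : (0 < n)%N ->
  taylor_rem m n.+1 z - taylor_rem m n z = - (z / n%:R) * taylor_rem m.-1 n z.
Proof.
move=> n0; rewrite /taylor_rem fall_prodS //; case: m => [|m] /=.
  by rewrite !big_ord0; ring.
rewrite !big_ord_recl /= !elem_harm0 !expr0.
under eq_bigr do rewrite /bump /= add1n elem_harmSS // mulrDr exprS -mulrA.
rewrite big_split /=.
under [in LHS]eq_bigr do rewrite mulrA -exprS.
have -> : \sum_(i < m) - z * (- z) ^+ i * (elem_harm i n / n%:R) =
   - (z / n%:R) * \sum_(i < m) (- z) ^+ i * elem_harm i n.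
  by rewrite mulr_sumr; apply: eq_bigr => i _; ring.
by under [in X in _ - (_ - X)]eq_bigr do rewrite /bump /= add1n; ring.
Qed.

Lemma taylor_rem1 m z : taylor_rem m.+1 1 z = 0.
Proof.
rewrite /taylor_rem fall_prod1 big_ord_recl big1 /= => [|i _].
  by rewrite elem_harm0 expr0 mulr1 addr0 subrr.
by rewrite /bump /= add1n elem_harmS1 mulr0.
Qed.

Lemma taylor_rem_bound m n (x : R) : (0 < n)%N -> 0 <= x <= 1 ->
  cnorm (taylor_rem m n (real_complex R x)) <= x ^+ m * hnum n ^+ m.
Proof.
move=> n0 /[dup] xb /andP[x0 x1].
(* The product at [l.+1] has exactly the factors [1, ..., l] counted by [hnum l]; in this sharper
   form the bound can be summed over [l]. *)
suff H l : cnorm (taylor_rem m l.+1 (real_complex R x)) <= x ^+ m * hnum l ^+ m.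
  case: n n0 => // n _; apply: le_trans (H n) _.
  by rewrite ler_wpM2l ?exprn_ge0 // hnumX_mono.
elim: m l => [|m IH] l.
  rewrite /taylor_rem big_ord0 subr0 fall_prod_real cnorm_real !expr0 mulr1.
  by have /andP[a b] := fall_prodR_bounds l.+1 xb; rewrite ger0_norm.
elim: l => [|l IHl]; first by rewrite taylor_rem1 cnorm0 mulr_ge0 ?hnumX_ge0 ?exprn_ge0.
rewrite -(subrK (taylor_rem m.+1 l.+1 (real_complex R x)) (taylor_rem _ l.+2 _)).
apply: le_trans (cnormD _ _) _.
rewrite taylor_rem_diff // cnormM cnormN cnormM cnormV cnorm_nat cnorm_real ger0_norm //=.
apply: le_trans (ler_wpM2l (exprn_ge0 m.+1 x0) (growth_step (lexx (hnum l ^+ m)))).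
rewrite mulrDr; apply: lerD => //.
apply: le_trans (ler_wpM2l _ (IH l)) _; first by rewrite divr_ge0.
by rewrite exprS le_eqVlt; apply/orP; left; apply/eqP; ring.
Qed.

Lemma slow_rem m (x : R) : 0 <= x <= 1 ->
  slowly_varying m (x ^+ m) (fun n => taylor_rem m n (real_complex R x)).
Proof.
move=> /[dup] xb /andP[x0 x1] n n0; split; first exact: taylor_rem_bound.
rewrite taylor_rem_diff // cnormM cnormN cnormM cnormV cnorm_nat cnorm_real ger0_norm //.
apply: le_trans (ler_wpM2l _ (taylor_rem_bound m.-1 n0 xb)) _; first by rewrite divr_ge0.
have -> : x / n%:R * (x ^+ m.-1 * hnum n ^+ m.-1) = (x * x ^+ m.-1) * (hnum n ^+ m.-1 / n%:R).
  by ring.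
apply: ler_pM; rewrite ?mulr_ge0 ?exprn_ge0 ?hnumX_ge0 ?invr_ge0 ?hnum_ge0 //.
  by case: m => [|m] /=; rewrite ?expr0 ?mulr1 // -exprS.
by rewrite ler_wpM2r // hnumX_le // leq_pred.
Qed.

(* [sum_n p n * fall_prod n z] has the asymptotic expansion [sum_k (- z)^k * T k] at [z = 0+],
with remainders bounded uniformly in the truncation. *)
Definition taylor_good (p T : nat -> C) :=
  [/\ forall k, ((fun B => \sum_(1 <= n < B) p n * elem_harm k n) @ \oo --> T k)%classic,
      forall m, exists2 A : R, 0 <= A & forall (x : R) B, 0 < x < 1 ->
        cnorm (\sum_(1 <= n < B) p n * taylor_rem m n (real_complex R x)) <= A * x ^+ m
    & exists c, exists2 A : R, 0 <= A & forall B,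
        \sum_(1 <= n < B) cnorm (p n) <= A * hnum B ^+ c].

Lemma osc_sum_norm th c M X B : 0 <= M -> oscillating th c M X ->
  \sum_(1 <= n < B) cnorm (X n) <= M * hnum B ^+ c.+1.
Proof.
move=> M0 HX; apply: (@le_trans _ _ (\sum_(1 <= n < B) M * hnum B ^+ c * n%:R^-1)).
  rewrite !big_nat; apply: ler_sum => n /andP[n0 nB].
  apply: le_trans (HX _ n0).1 _; rewrite mulrA ler_wpM2r // ler_wpM2l // hnumX_mono //.
  exact: ltnW.
rewrite -mulr_sumr exprSr mulrA ler_wpM2l ?mulr_ge0 ?hnumX_ge0 //.
case: B => [|B]; first by rewrite big_geq ?hnum_ge0.
rewrite big_add1 /= hnumS /hnum [X in _ <= X + _]addrC -addrA lerDl addr_ge0 //.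
Qed.

(** The Taylor remainder varies slowly with constant [x ^+ m], so its product with [X] still
    oscillates and [osc_sum_bounded] applies uniformly in [x] and in the truncation. *)
Lemma osc_good th c M X T : th != 1 -> 0 <= M -> oscillating th c M X ->
  (forall k, ((fun B => \sum_(1 <= n < B) X n * elem_harm k n) @ \oo --> T k)%classic) ->
  taylor_good X T.
Proof.
move=> th1 M0 HX HT; split=> //.
  move=> m; have [A A0 HA] := osc_sum_bounded (c + m) th1.
  have K1 : 0 <= M * (1 + 2 ^+ m + cnorm th).
    by rewrite mulr_ge0 // !addr_ge0 ?cnorm_ge0 // exprn_ge0.
  exists (A * (M * (1 + 2 ^+ m + cnorm th))) => [|x B /andP[x0 x1]]; first by rewrite mulr_ge0.
  have xb : 0 <= x <= 1 by rewrite !ltW.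
  rewrite -mulrA; apply: HA; first by rewrite mulr_ge0 ?exprn_ge0 // ltW.
  apply: osc_slow => //; first by rewrite exprn_ge0 // ltW.
  exact: slow_rem.
by exists c.+1, M => // B; exact: osc_sum_norm HX.
Qed.

Lemma good0 : taylor_good (fun=> 0) (fun=> 0).
Proof.
split=> [k|m|].
- have -> : (fun B => \sum_(1 <= n < B) 0 * elem_harm k n) = (fun=> 0).
    by apply/funext => B; rewrite big1 // => i _; rewrite mul0r.
  exact: cvgC_cst.
- by exists 0 => // x B _; rewrite big1 ?cnorm0 ?mul0r // => i _; rewrite mul0r.
by exists 0%N, 0 => // B; rewrite big1 ?mul0r // => i _; rewrite cnorm0.
Qed.

Lemma goodD p T p' T' : taylor_good p T -> taylor_good p' T' ->
  taylor_good (fun n => p n + p' n) (fun k => T k + T' k).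
Proof.
move=> [h1 h2 [c [A A0 h3]]] [h1' h2' [c' [A' A'0 h3']]]; split=> [k|m|].
- under eq_fun do (under eq_bigr do rewrite mulrDl; rewrite big_split /=).
  exact: cvgCD.
- have [D D0 H] := h2 m; have [D' D'0 H'] := h2' m.
  exists (D + D') => [|x B xb]; first exact: addr_ge0.
  under eq_bigr do rewrite mulrDl.
  by rewrite big_split /= mulrDl; apply: le_trans (cnormD _ _) (lerD (H _ _ xb) (H' _ _ xb)).
exists (c + c')%N, (A + A') => [|B]; first exact: addr_ge0.
apply: (@le_trans _ _ (\sum_(1 <= n < B) (cnorm (p n) + cnorm (p' n)))).
  by apply: ler_sum => i _; exact: cnormD.
rewrite big_split mulrDl /=; apply: lerD.
  by apply: le_trans (h3 B) _; rewrite ler_wpM2l // hnumX_le // leq_addr.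
by apply: le_trans (h3' B) _; rewrite ler_wpM2l // hnumX_le // leq_addl.
Qed.

Lemma goodZ a p T : taylor_good p T -> taylor_good (fun n => a * p n) (fun k => a * T k).
Proof.
move=> [h1 h2 [c [A A0 h3]]]; split=> [k|m|].
- under eq_fun do (under eq_bigr do rewrite -mulrA; rewrite -mulr_sumr).
  by apply: cvgCM => //; exact: cvgC_cst.
- have [D D0 H] := h2 m; exists (cnorm a * D) => [|x B xb]; first by rewrite mulr_ge0 ?cnorm_ge0.
  under eq_bigr do rewrite -mulrA.
  by rewrite -mulr_sumr cnormM -mulrA ler_wpM2l ?cnorm_ge0 // H.
exists c, (cnorm a * A) => [|B]; first by rewrite mulr_ge0 ?cnorm_ge0.
under eq_bigr do rewrite cnormM.
by rewrite -mulr_sumr -mulrA ler_wpM2l ?cnorm_ge0.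
Qed.

Lemma good_sum I (r : seq I) (a : I -> C) (p T : I -> nat -> C) :
  List.Forall (fun i => a i = 0 \/ taylor_good (p i) (T i)) r ->
  taylor_good (fun n => \sum_(i <- r) a i * p i n) (fun k => \sum_(i <- r) a i * T i k).
Proof.
elim: r => [|i r IH] H.
  under eq_fun do rewrite big_nil; under [X in taylor_good _ X]eq_fun do rewrite big_nil.
  exact: good0.
under eq_fun do rewrite big_cons; under [X in taylor_good _ X]eq_fun do rewrite big_cons.
have h1 := List.Forall_inv H; have h2 := IH (List.Forall_inv_tail H).
apply: goodD h2; case: h1 => [->|]; last exact: goodZ.
under eq_fun do rewrite mul0r; under [X in taylor_good _ X]eq_fun do rewrite mul0r.
exact: good0.
Qed.

End Oscillation.

(** * Hausdorff variation *)

Section Variation.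
Variable R : realType.
Local Notation C := (Cplx R).
Local Notation hnum := (hnum R).
Implicit Types (K a G : nat -> C) (n c d B k m i j b : nat) (M : R).

(** For a moment sequence [K n = \int_0^1 u^n dmu(u)] this is [\int_0^1 u^i (1 - u)^n dmu(u)]. *)
Fixpoint bdiff K n i : C := if n is n'.+1 then bdiff K n' i - bdiff K n' i.+1 else K i.

Lemma bdiff_sum a n i : bdiff (fun N => \sum_(0 <= j < N) a j) n.+1 i = - bdiff a n i.
Proof.
elim: n i => [|n IH] i; first by rewrite /= big_nat_recr //= opprD addrA subrr add0r.
by rewrite /= -/(bdiff _ n.+1 i) -/(bdiff _ n.+1 i.+1) !IH; ring.
Qed.

(** Leibniz rule for iterated differences of the quotient sequence times the linear sequence [j.+1].
    At [n = 0] the coefficient [n] removes the term with [n.-1]. *)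
Lemma bdiff_div a n i :
  (i + n).+1%:R * bdiff (fun j => a j / j.+1%:R) n i =
  n%:R * bdiff (fun j => a j / j.+1%:R) n.-1 i + bdiff a n i.
Proof.
set A := fun j => _.
elim: n i => [|n IH] i.
  by rewrite addn0 mul0r add0r /= mulrC divfK // pnatr_eq0.
have H1 := IH i; have H2 := IH i.+1.
rewrite /= -[bdiff a n i](addKr (n%:R * bdiff A n.-1 i)) -H1.
rewrite -[bdiff a n i.+1](addKr (n%:R * bdiff A n.-1 i.+1)) -H2.
have : n%:R * bdiff A n.-1 i.+1 = n%:R * (bdiff A n.-1 i - bdiff A n i).
  by case: (n) => [|n']; rewrite ?mul0r //=; ring.
move=> ->; rewrite addSn addnS -!natr1 natrD; ring.
Qed.

Lemma bdiff_const (e : C) n i : bdiff (fun=> e) n i = if n is _.+1 then 0 else e.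
Proof. by elim: n i => //= n IH i; rewrite !IH; case: n {IH}; rewrite subrr. Qed.

Definition variation_term K b i : R := 'C(b, i)%:R * cnorm (bdiff K (b - i) i).

Lemma variation_term_ge0 K b i : 0 <= variation_term K b i.
Proof. by rewrite mulr_ge0 ?cnorm_ge0. Qed.

(* If [K n = \int_0^1 u^n dmu(u)], then [variation K b] is at most the total variation of [mu]. *)
Definition variation K b : R := \sum_(i < b.+1) variation_term K b i.

(** The variation at [B] of the partial sums of [K], without its last term: one order of
    differencing undoes the summation. *)
Definition shifted_variation K B : R := \sum_(i < B) 'C(B, i)%:R * cnorm (bdiff K (B.-1 - i) i).

Lemma cnorm_le_variation K b : cnorm (K b) <= variation K b.
Proof.
rewrite /variation big_ord_recr /= /variation_term subnn binn mul1r lerDr.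
by apply: sumr_ge0 => i _; exact: variation_term_ge0.
Qed.

Lemma variation_le_shifted K b : variation K b <= shifted_variation K b.+1.
Proof.
apply: ler_sum => i _; rewrite /variation_term ler_wpM2r ?cnorm_ge0 // ler_nat.
by rewrite leq_bin2l.
Qed.

Lemma bin_down B i : ((B.+1 - i) * 'C(B.+1, i) = B.+1 * 'C(B, i))%N.
Proof. by rewrite -mul_bin_down. Qed.

(** Induction on [B]: by [bin_down] and [bdiff_div], passing from [B] to [B.+1] costs at most one
    more [variation_term a B i]. *)
Lemma shifted_variation_term a B i : (i < B)%N ->
  (B - i)%:R * ('C(B, i)%:R * cnorm (bdiff (fun j => a j / j.+1%:R) (B.-1 - i) i)) <=
  \sum_(b < B | (i <= b)%N) variation_term a b i.
Proof.
set A := fun j => _.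
elim: B => // B IH; rewrite ltnS leq_eqVlt => /orP[/eqP->|iB].
  rewrite subSnn mul1r /= subnn binSn /A cnormM cnormV cnorm_nat.
  rewrite mulrCA mulfV ?pnatr_eq0 // mulr1 big_mkcond big_ord_recr /= leqnn.
  rewrite /variation_term subnn binn mul1r lerDr sumr_ge0 // => b _.
  by case: ifP => // _; exact: variation_term_ge0.
rewrite big_mkcond big_ord_recr /= (ltnW iB) -big_mkcond /=.
apply: le_trans (_ : _ <= (B - i)%:R * ('C(B, i)%:R * cnorm (bdiff A (B.-1 - i) i)) + _) _;
  last first.
  by apply: lerD => //; exact: IH.
rewrite mulrA -natrM bin_down natrM /variation_term.
have H := bdiff_div a (B - i) i; rewrite (subnKC (ltnW iB)) -/A in H.
have -> : (B.-1 - i)%N = (B - i).-1 by lia.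
rewrite [B.+1%:R * _]mulrC -mulrA -[B.+1%:R]cnorm_nat -cnormM H.
rewrite mulrCA -mulrDr ler_wpM2l //; apply: le_trans (cnormD _ _) _.
by rewrite cnormM cnorm_nat.
Qed.

(** Divide [shifted_variation_term] by [B - i], weaken [1 / (B - i)] to [1 / (B - b)] for [i <= b],
    and exchange the sums: the inner ones become variations, the outer one a harmonic number. *)
Lemma shifted_variation_div_le a B M : 0 <= M -> (forall b, (b < B)%N -> variation a b <= M) ->
  shifted_variation (fun j => a j / j.+1%:R) B <= M * hnum B.
Proof.
move=> M0 HM; set A := fun j => _.
apply: (@le_trans _ _ (\sum_(i < B) \sum_(b < B | (i <= b)%N) variation_term a b i / (B - b)%:R)).
  apply: ler_sum => i _; have iB : 0 < (B - i)%:R :> R by rewrite ltr0n subn_gt0.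
  rewrite -(ler_pM2l iB); apply: le_trans (shifted_variation_term a (ltn_ord i)) _.
  rewrite mulr_sumr; apply: ler_sum => b ib.
  rewrite mulrCA ler_peMr ?variation_term_ge0 // ler_pdivlMr ?ltr0n ?subn_gt0 // mul1r ler_nat.
  exact: leq_sub2l.
rewrite (exchange_big_dep predT) //=.
apply: (@le_trans _ _ (\sum_(b < B) M / (B - b)%:R)).
  apply: ler_sum => b _; rewrite -mulr_suml ler_wpM2r ?invr_ge0 //.
  apply: le_trans (HM b (ltn_ord b)); rewrite /variation (big_ord_widen B) ?ltn_ord //.
rewrite -mulr_sumr ler_wpM2l // (reindex_inj rev_ord_inj) /= /hnum big_mkord.
under eq_bigr => i _.
  have -> : (B - (B - i.+1))%N = i.+1 by have := ltn_ord i; lia.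
  over.
by rewrite lerDr.
Qed.

Definition polylog_variation K := exists c, exists2 M : R, 0 <= M & forall B, variation K B <=
  M * hnum B ^+ c.

Lemma polylog_variation_shifted a : polylog_variation a -> exists c, exists2 M : R, 0 <= M &
  forall B, shifted_variation (fun j => a j / j.+1%:R) B <= M * hnum B ^+ c.
Proof.
move=> [c [M M0 H]]; exists c.+1, M => // B.
rewrite exprSr mulrA; apply: shifted_variation_div_le => [|b bB];
  first by rewrite mulr_ge0 ?hnumX_ge0.
by apply: le_trans (H b) _; rewrite ler_wpM2l // hnumX_mono // ltnW.
Qed.

Lemma polylog_variation_div a : polylog_variation a -> polylog_variation (fun j => a j / j.+1%:R).
Proof.
move=> /polylog_variation_shifted[c [M M0 H]]; exists c, (M * 2 ^+ c) => [|B].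
  by rewrite mulr_ge0 ?exprn_ge0.
apply: le_trans (variation_le_shifted _ _) _; apply: le_trans (H _) _.
by rewrite -mulrA ler_wpM2l // hnumX_le2.
Qed.

Lemma polylog_variation_sum a : polylog_variation a ->
  polylog_variation (fun N => \sum_(0 <= j < N) a j / j.+1%:R).
Proof.
move=> Ha; have [c [M M0 H]] := polylog_variation_shifted Ha; have [c' [M' M'0 H']] := Ha.
exists (c + c'.+1)%N, (M + M') => [|B]; first exact: addr_ge0.
(* The terms [i < B] form the shifted variation; the term [i = B] is the partial sum itself, bounded
   termwise. *)
rewrite /variation big_ord_recr /= /variation_term subnn binn mul1r mulrDl /=; apply: lerD.
  apply: (@le_trans _ _ (shifted_variation (fun j => a j / j.+1%:R) B)).
    apply: ler_sum => i _; rewrite ler_wpM2l //.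
    have iB := ltn_ord i.
    have -> : (B - i)%N = (B.-1 - i).+1 by lia.
    by rewrite bdiff_sum cnormN.
  by apply: le_trans (H B) _; rewrite ler_wpM2l // hnumX_le // leq_addr.
apply: le_trans (cnorm_sum _ _ _) _.
apply: (@le_trans _ _ (\sum_(0 <= j < B) M' * hnum B ^+ c' * j.+1%:R^-1)).
  rewrite !big_nat; apply: ler_sum => j /andP[_ jB].
  rewrite cnormM cnormV cnorm_nat ler_wpM2r // (le_trans (cnorm_le_variation _ _)) // (le_trans
    (H' _)) //.
  by rewrite ler_wpM2l // hnumX_mono // ltnW.
rewrite -mulr_sumr -mulrA ler_wpM2l //.
apply: (@le_trans _ _ (hnum B ^+ c'.+1)); last by rewrite hnumX_le // leq_addl.
by rewrite exprSr ler_wpM2l ?hnumX_ge0 // /hnum lerDr.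
Qed.

Lemma polylog_variation_const (e : C) : polylog_variation (fun=> e).
Proof.
exists 0%N, (cnorm e) => [|B]; first exact: cnorm_ge0.
rewrite /variation big_ord_recr /= big1 => [|i _].
  by rewrite /variation_term subnn binn mul1r add0r expr0 mulr1.
have iB := ltn_ord i; rewrite /variation_term bdiff_const.
have -> : (B - i)%N = (B.-1 - i).+1 by lia.
by rewrite cnorm0 mulr0.
Qed.

(** When all roots of unity are 1, a nested sum is built from a constant by dividing by [j.+1] and
    taking partial sums, and each operation costs at most a power of [hnum]. *)
Lemma polylog_variation_Gsum (zs : seq (nat * C)) :
  all (fun t : nat * C => (0 < t.1)%N && (t.2 == 1)) zs ->
    polylog_variation (fun N => Gsum zs 1 N.+1).
Proof.
elim: zs => [_|[k t] zs IH /= /andP[/andP[k0 /eqP->] /IH Hz]].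
  have -> : (fun N => Gsum [::] 1 N.+1) = (fun=> 1 : C).
    by apply/funext => N /=; rewrite expr1n.
  exact: polylog_variation_const.
have HD d : polylog_variation (fun j => Gsum zs 1 j.+1 / j.+1%:R ^+ d).
  elim: d => [|d IHd].
    by under eq_fun do rewrite expr0 divr1.
  under eq_fun do rewrite exprSr invfM mulrA.
  exact: polylog_variation_div.
have -> : (fun N : nat => \sum_(1 <= m < N.+1) (1 : C) ^+ (N.+1 - m) *
    ((m%:R ^+ k)^-1 * Gsum zs 1 m)) =
   (fun N => \sum_(0 <= j < N) Gsum zs 1 j.+1 / j.+1%:R ^+ k.-1 / j.+1%:R).
  apply/funext => N; rewrite big_add1 /=; apply: eq_bigr => j _.
  rewrite expr1n mul1r mulrC -mulrA; congr (_ * _).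
  by rewrite -invfM -exprSr prednK.
exact: polylog_variation_sum.
Qed.

End Variation.

(** * Newton interpolation *)

Section PolynomialFunctions.
Variable F : numFieldType.
Implicit Types (f g : F -> F) (d m n : nat).

(** Here [d] bounds the size, not the degree, so it is the number of nodes that determine [f]. *)
Definition is_poly d f := exists2 p : {poly F}, (size p <= d)%N & forall z, f z = p.[z].

Lemma is_poly_uniq d m f g : is_poly d f -> is_poly d g ->
  (forall i, (i < d)%N -> f (m + i)%:R = g (m + i)%:R) -> forall z, f z = g z.
Proof.
move=> [p sp fp] [q sq gq] fg z; apply/eqP; rewrite -subr_eq0 fp gq -hornerN -hornerD.
suff -> : p - q = 0 by rewrite horner0.
apply: (@roots_geq_poly_eq0 _ _ [seq (m + i)%:R | i <- iota 0 d]).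
- apply/allP => _ /mapP[i + ->]; rewrite mem_iota add0n => /= id.
  by rewrite rootE hornerD hornerN -fp -gq fg // subrr.
- rewrite map_inj_uniq ?iota_uniq // => i j /eqP.
  by rewrite eqr_nat eqn_add2l => /eqP.
rewrite size_map size_iota; apply: leq_trans (size_polyD _ _) _.
by rewrite size_polyN geq_max sp.
Qed.

Lemma is_poly_le d d' f : (d <= d')%N -> is_poly d f -> is_poly d' f.
Proof. by move=> dd' [p sp fp]; exists p => //; apply: leq_trans dd'. Qed.

Lemma is_poly_cst c : is_poly 1 (fun=> c).
Proof. by exists c%:P => [|z]; rewrite ?size_polyC_leq1 ?hornerC. Qed.

Lemma is_polyZ d c f : is_poly d f -> is_poly d (fun z => c * f z).
Proof.
move=> [p sp fp]; exists (c *: p) => [|z]; last by rewrite hornerZ fp.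
exact: leq_trans (size_scale_leq _ _) sp.
Qed.

Lemma is_polyD d f g : is_poly d f -> is_poly d g -> is_poly d (fun z => f z + g z).
Proof.
move=> [p sp fp] [q sq gq]; exists (p + q) => [|z]; last by rewrite hornerD fp gq.
by apply: leq_trans (size_polyD _ _) _; rewrite geq_max sp.
Qed.

Lemma is_polyMX d f : is_poly d f -> is_poly d.+1 (fun z => z * f z).
Proof.
move=> [p sp fp]; exists (p * 'X) => [|z]; last by rewrite hornerMX fp mulrC.
by apply: leq_trans (size_polyMleq _ _) _; rewrite size_polyX addn2.
Qed.

Lemma is_poly_factor d f a : is_poly d f -> is_poly d.+1 (fun z => f z * (1 - z / a)).
Proof.
move=> fd; have -> : (fun z => f z * (1 - z / a)) = (fun z => f z + - a^-1 * (z * f z)).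
  by apply/funext => z; ring.
by apply: is_polyD; [exact: is_poly_le fd|apply: is_polyZ; exact: is_polyMX].
Qed.

Lemma is_poly_prod d f m n : is_poly d f ->
  is_poly (d + n) (fun z => f z * \prod_(m <= l < m + n) (1 - z / l%:R)).
Proof.
move=> fd; elim: n => [|n IH].
  by rewrite !addn0; under eq_fun do rewrite big_geq // mulr1.
rewrite !addnS; under eq_fun do rewrite big_nat_recr ?leq_addr //= mulrA.
exact: is_poly_factor.
Qed.

Lemma is_poly_sum d m n (G : nat -> F -> F) :
  (forall i, (m <= i < n)%N -> is_poly d (G i)) ->
  is_poly d (fun z => \sum_(m <= i < n) G i z).
Proof.
elim: n => [|n IH] H.
  by exists 0 => [|z]; rewrite ?size_poly0 // big_geq // horner0.
case: (leqP m n) => mn; last first.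
  by exists 0 => [|z]; rewrite ?size_poly0 // big_geq // horner0.
under eq_fun do rewrite big_nat_recr //=.
apply: is_polyD; last by apply: H; rewrite mn /=.
by apply: IH => i /andP[mi iN]; apply: H; rewrite mi ltnW.
Qed.

End PolynomialFunctions.

(** * Interpolating a sequence and its products with Newton series *)

Section Interpolation.
Variable R : realType.
Local Notation C := (Cplx R).
Local Notation hnum := (hnum R).
Implicit Types (K p q : nat -> C) (n c d B k m i j b N : nat) (M : R) (z : C) (x : R).

Definition newton_tail B i z : C := \prod_(i.+1 <= l < B.+1) (1 - z / l%:R).

(* Interpolates [K] at [j, ..., B]; in this form, adding the nodes [0, ..., j - 1] only adds
the terms with [i < j]. *)
Definition newton_interp K B j z : C :=
  \sum_(j <= i < B.+1) 'C(B, i)%:R * bdiff K (B - i) i * newton_tail B i z.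

Lemma newton_tail_nat0 B i N : (i < N <= B)%N -> newton_tail B i N%:R = 0.
Proof.
move=> /andP[iN NB]; apply/eqP; rewrite prodf_seq_eq0; apply/hasP; exists N.
  by rewrite mem_index_iota iN ltnS.
by rewrite /= divff ?subrr // pnatr_eq0; lia.
Qed.

(** Induction on [B]: after multiplication by [B.+1 - i], both sides gain the factor [B.+1 - N]. *)
Lemma newton_tail_nat B i N : (N <= i <= B)%N ->
  'C(B, i)%:R * newton_tail B i N%:R = 'C(B - N, i - N)%:R.
Proof.
move=> /andP[Ni]; elim: B => [|B IH].
  by rewrite leqn0 => /eqP i0; rewrite /newton_tail big_geq ?i0 // mulr1; congr (_%:R);
    move: Ni; rewrite i0 leqn0 => /eqP ->.
rewrite leq_eqVlt => /orP[/eqP->|]; first by rewrite /newton_tail big_geq // mulr1 !binn.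
rewrite ltnS => iB.
have -> : newton_tail B.+1 i N%:R = newton_tail B i N%:R * (1 - N%:R / B.+1%:R).
  by rewrite /newton_tail big_nat_recr.
have d0 : (B.+1 - i)%:R != 0 :> C by rewrite pnatr_eq0; lia.
apply: (mulfI d0).
rewrite [LHS]mulrA -[(B.+1 - i)%:R * 'C(B.+1, i)%:R]natrM bin_down natrM.
have -> : B.+1%:R * 'C(B, i)%:R * (newton_tail B i N%:R * (1 - N%:R / B.+1%:R)) =
   (B.+1%:R - N%:R) * ('C(B, i)%:R * newton_tail B i N%:R) :> C.
  have b0 : B.+1%:R != 0 :> C by rewrite pnatr_eq0.
  by move: (B.+1%:R : C) b0 => b b0; field.
rewrite IH // -natrB; last by lia.
rewrite -!natrM; congr (_%:R).
have -> : (B.+1 - N)%N = (B - N).+1 by lia.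
have -> : (B.+1 - i)%N = ((B - N).+1 - (i - N))%N by lia.
by rewrite bin_down.
Qed.

(** For moments this is [u^N (u + (1 - u))^n = u^N]; in general it follows from Pascal's rule. *)
Lemma bdiff_inv K n N : \sum_(j < n.+1) 'C(n, j)%:R * bdiff K (n - j) (N + j) = K N.
Proof.
elim: n N => [|n IH] N; first by rewrite big_ord1 bin0 mul1r addn0.
rewrite -[RHS]IH big_ord_recl /= bin0 mul1r addn0.
under eq_bigr do rewrite /bump /= add1n binS natrD mulrDl subSS addnS.
rewrite big_split /= big_ord_recr /= bin_small // mul0r addr0 addrA.
have -> : bdiff K n N - bdiff K n N.+1 +
    \sum_(i < n) 'C(n, i.+1)%:R * bdiff K (n - i) (N + i).+1 =
    \sum_(j < n.+1) 'C(n, j)%:R * bdiff K (n.+1 - j) (N + j).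
  rewrite big_ord_recl bin0 mul1r addn0; congr (_ + _).
  by apply: eq_bigr => i _; rewrite lift0 subSS addnS.
rewrite -big_split; apply: eq_bigr => j _ /=.
by rewrite -mulrDr subSn ?subrK // -ltnS.
Qed.

Lemma newton_interp_nat K B j N : (j <= N <= B)%N -> newton_interp K B j N%:R = K N.
Proof.
move=> /andP[jN NB]; rewrite /newton_interp (big_cat_nat jN) ?leqW //=.
rewrite big_nat big1 ?add0r => [|i /andP[ji iN]]; last first.
  by rewrite newton_tail_nat0 ?mulr0 // iN.
rewrite -[RHS](bdiff_inv K (B - N) N) -{1}[N]add0n big_addn subSn // big_mkord.
apply: eq_bigr => i _; have iB := ltn_ord i.
rewrite mulrAC newton_tail_nat; last by lia.
by rewrite addnK addnC; congr (_ * bdiff K _ _); lia.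
Qed.

Lemma fall_prod_nat0 n N : (0 < N < n)%N -> fall_prod n (N%:R : C) = 0.
Proof.
move=> /andP[N0 Nn]; apply/eqP; rewrite prodf_seq_eq0; apply/hasP; exists N.
  by rewrite mem_index_iota N0.
by rewrite /= divff ?subrr // pnatr_eq0; lia.
Qed.

Lemma is_poly_fall_prod n : (0 < n)%N -> is_poly n (@fall_prod R n).
Proof.
move=> n0; have := @is_poly_prod C 1 _ 1 n.-1 (is_poly_cst 1).
rewrite !add1n prednK //; under [X in is_poly _ X -> _]eq_fun do rewrite mul1r; exact.
Qed.

Lemma is_poly_newton_interp K B j : (0 < j <= B)%N ->
  is_poly B (fun z => fall_prod j z * newton_interp K B j z).
Proof.
move=> /andP[j0 jB].
have -> : (fun z => fall_prod j z * newton_interp K B j z) = (fun z => \sum_(j <= i < B.+1)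
    ('C(B, i)%:R * bdiff K (B - i) i) * (fall_prod j z * newton_tail B i z)).
  by apply/funext => z; rewrite mulr_sumr; apply: eq_bigr => i _; rewrite mulrCA.
apply: is_poly_sum => i /andP[ji iB]; apply: is_polyZ.
have := @is_poly_prod C j _ i.+1 (B - i) (is_poly_fall_prod j0).
rewrite /newton_tail; have -> : (i.+1 + (B - i))%N = B.+1 by lia.
by apply: is_poly_le; lia.
Qed.

Lemma is_poly_newton_interp0 K B : is_poly B.+1 (newton_interp K B 0).
Proof.
apply: is_poly_sum => i /andP[_ iB]; apply: is_polyZ.
have := @is_poly_prod C 1 _ i.+1 (B - i) (is_poly_cst 1).
under [X in is_poly _ X -> _]eq_fun do rewrite mul1r.
rewrite /newton_tail; have -> : (i.+1 + (B - i))%N = B.+1 by lia.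
by apply: is_poly_le; lia.
Qed.

Lemma sum_fall_prod_trunc p N B : (0 < N <= B)%N -> 
  \sum_(1 <= j < B.+1) p j * fall_prod j (N%:R : C) = \sum_(1 <= j < N.+1) p j * fall_prod j N%:R.
Proof.
move=> /andP[N0 NB]; rewrite (@big_cat_nat _ _ _ N.+1) //=.
rewrite [X in _ + X]big_nat [X in _ + X]big1 ?addr0 // => i /andP[Ni _].
by rewrite fall_prod_nat0 ?mulr0 // N0.
Qed.

Section Core.
Variables (p p' q K : nat -> C).
Hypothesis HpK : forall N, (0 < N)%N ->
  (\sum_(1 <= j < N.+1) p j * fall_prod j N%:R) * K N =
    \sum_(1 <= j < N.+1) p' j * fall_prod j N%:R.
Hypothesis HqK : forall N, K N = - (N%:R * \sum_(1 <= j < N.+1) q j * fall_prod j N%:R).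

(** Both sides have degree below [B] and agree at [1, ..., B]. Since [fall_prod j] vanishes at
    [1, ..., j - 1], its cofactor needs to match [K] only at [j, ..., B]. *)
Lemma newton_product B z :
  \sum_(1 <= j < B.+1) p j * (fall_prod j z * newton_interp K B j z) =
    \sum_(1 <= j < B.+1) p' j * fall_prod j z.
Proof.
apply: (@is_poly_uniq _ B 1 (fun z => \sum_(1 <=
  j < B.+1) p j * (fall_prod j z * newton_interp K B j z))
  (fun z => \sum_(1 <= j < B.+1) p' j * fall_prod j z)) => [||i iB].
- by apply: is_poly_sum => j /andP[j0 jB]; apply: is_polyZ; apply: is_poly_newton_interp;
  rewrite j0.
- apply: is_poly_sum => j /andP[j0 jB]; apply: is_polyZ.
  by apply: is_poly_le (is_poly_fall_prod j0).
rewrite add1n [RHS]sum_fall_prod_trunc //= -HpK // -(sum_fall_prod_trunc _ (B := B)) // mulr_suml.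
rewrite !big_nat; apply: eq_bigr => j /andP[j0 jB].
case: (leqP j i.+1) => ji; first by rewrite newton_interp_nat ?ji // mulrA.
by rewrite fall_prod_nat0 ?ji // mul0r !mulr0 mul0r.
Qed.

(** Uniqueness of interpolation at the [B.+1] nodes [0, ..., B]; the factor [z] accounts for
    [K 0 = 0]. *)
Lemma newton_K B z : newton_interp K B 0 z = - (z * \sum_(1 <= j < B.+1) q j * fall_prod j z).
Proof.
apply: (@is_poly_uniq _ B.+1 0 (newton_interp K B 0)
   (fun z => - (z * \sum_(1 <= j < B.+1) q j * fall_prod j z))) => [||i iB].
- exact: is_poly_newton_interp0.
- under eq_fun do rewrite -mulN1r.
  apply: is_polyZ; apply: is_polyMX; apply: is_poly_sum => j /andP[j0 jB]; apply: is_polyZ.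
  by apply: is_poly_le (is_poly_fall_prod j0).
rewrite add0n newton_interp_nat // HqK; congr (- _).
by case: i iB => [|i] iB; rewrite ?mul0r // [in RHS]sum_fall_prod_trunc.
Qed.

(* The terms [i < j] of the interpolant carry the factors [1 - z / l] for [i < l <= B], which
together with those of [fall_prod j] contain all the factors of [fall_prodR B.+1]. *)
Lemma newton_interp_shift_bound B j x : (0 < j <= B.+1)%N -> 0 <= x <= 1 ->
  cnorm (fall_prod j (real_complex R x) *
    (newton_interp K B 0 (real_complex R x) - newton_interp K B j (real_complex R x)))
  <= variation K B * fall_prodR B.+1 x.
Proof.
move=> /andP[j0 jB] xb.
rewrite {1}/newton_interp (@big_cat_nat _ _ _ j) //= -/(newton_interp K B j _) addrK mulr_sumr.
apply: le_trans (cnorm_sum _ _ _) _; rewrite /variation mulr_suml big_mkord.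
rewrite (big_ord_widen B.+1 (fun i => cnorm (fall_prod j (real_complex R x) *
   ('C(B, i)%:R * bdiff K (B - i) i * newton_tail B i (real_complex R x))))) //.
rewrite big_mkcond; apply: ler_sum => i _.
have /andP[pB0 pB1] := fall_prodR_bounds B.+1 xb.
case: ifP => ij; last by rewrite mulr_ge0 ?variation_term_ge0.
rewrite mulrCA cnormM /variation_term cnormM cnorm_nat ler_wpM2l ?mulr_ge0 ?cnorm_ge0 //.
have sE : newton_tail B i (real_complex R x) =
  real_complex R (\prod_(i.+1 <= l < B.+1) (1 - x / l%:R)).
  rewrite rmorph_prod; apply: eq_bigr => l _.
  by rewrite rmorphB rmorph1 fmorph_div /= rmorph_nat.
rewrite sE fall_prod_real cnormM !cnorm_real.
have fb l : 0 <= 1 - x / l.+1%:R <= 1 by exact: factor_bounds.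
have pr0 m n : 0 <= \prod_(m.+1 <= l < n.+1) (1 - x / l%:R).
  rewrite big_nat_cond prodr_ge0 // => -[//|l] _; by have /andP[] := fb l.
have pr1 m n : \prod_(m.+1 <= l < n.+1) (1 - x / l%:R) <= 1.
  rewrite big_nat_cond; elim/big_rec: _ => // -[//|l] y _ Hy; have /andP[a b] := fb l.
  by apply: le_trans (ler_wpM2l a Hy) _; rewrite mulr1.
have /andP[pj0 _] := fall_prodR_bounds j xb.
rewrite !ger0_norm //.
have -> : fall_prodR B.+1 x = fall_prodR i.+1 x * \prod_(i.+1 <= l < B.+1) (1 - x / l%:R).
  by rewrite /fall_prodR -big_cat_nat.
rewrite ler_wpM2r //.
have -> : fall_prodR j x = fall_prodR i.+1 x * \prod_(i.+1 <= l < j.-1.+1) (1 - x / l%:R).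
  by rewrite /fall_prodR -big_cat_nat //= prednK.
have /andP[a _] := fall_prodR_bounds i.+1 xb.
by rewrite ler_piMr.
Qed.

(** The true product interpolates [K] at [0, ..., B] in every term, whereas [newton_product] uses
    only the nodes [j, ..., B] in the term [j]; the discrepancy is estimated term by term. *)
Lemma product_error B x : 0 <= x <= 1 ->
  cnorm ((\sum_(1 <= j < B.+1) p j * fall_prod j (real_complex R x)) *
      - (real_complex R x * \sum_(1 <= j < B.+1) q j * fall_prod j (real_complex R x)) -
      \sum_(1 <= j < B.+1) p' j * fall_prod j (real_complex R x)) <=
  (\sum_(1 <= j < B.+1) cnorm (p j)) * (variation K B * fall_prodR B.+1 x).
Proof.
move=> xb; rewrite -newton_K -newton_product mulr_suml -sumrB.
apply: le_trans (cnorm_sum _ _ _) _; rewrite mulr_suml !big_nat.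
apply: ler_sum => j /andP[j0 jB].
rewrite -mulrA -mulrBr -mulrBr cnormM ler_wpM2l ?cnorm_ge0 //.
by apply: newton_interp_shift_bound => //; rewrite j0 ltnW.
Qed.

End Core.

End Interpolation.

(** * Taylor coefficients of a product of Newton series *)

Section TaylorCoefficients.
Variable R : realType.
Local Notation C := (Cplx R).
Local Notation hnum := (hnum R).
Local Notation rC := (real_complex R).
Implicit Types (K p q T S : nat -> C) (n c d B k m i j b N : nat) (M : R) (z : C) (x : R).

Lemma horner_bound (P : {poly C}) : exists2 D : R, 0 <= D &
  forall x, 0 < x < 1 -> cnorm P.[- rC x] <= D.
Proof.
exists (\sum_(i < size P) cnorm P`_i) => [|x /andP[x0 x1]].
  by rewrite sumr_ge0 // => i _; exact: cnorm_ge0.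
rewrite horner_coef; apply: le_trans (cnorm_sum _ _ _) _; apply: ler_sum => i _.
by rewrite cnormM cnormX cnormN cnorm_real gtr0_norm // ler_piMr ?cnorm_ge0 // exprn_ile1 // ltW.
Qed.

(** Letting [x] tend to 0 kills the constant coefficient; then divide by the variable and induct on
    [m]. *)
Lemma small_poly_coef m (P : {poly C}) (A : R) : 0 <= A ->
  (forall x, 0 < x < 1 -> cnorm P.[- rC x] <= A * x ^+ m) -> forall k, (k < m)%N -> P`_k = 0.
Proof.
move=> A0; elim: m P => // m IH P; elim/poly_ind: P => [|P a _] HP k.
  by rewrite coef0.
have [D D0 HD] := horner_bound P.
have HE x : (P * 'X + a%:P).[- rC x] = a - P.[- rC x] * rC x.
  by rewrite hornerD hornerMX hornerC; ring.
have a0 : a = 0.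
  apply/eqP; rewrite -cnorm_eq0; apply/eqP/le_anti; rewrite cnorm_ge0 andbT.
  apply/ler_addgt0Pr => e e0; rewrite add0r.
  (* The first entry keeps [x] below 1, the second makes [(A + D + 1) * x <= e]; the added 1 keeps
     the denominator positive. *)
  pose x := Num.min (2^-1) (e / (A + D + 1)).
  have AD : 0 < A + D + 1 by lra.
  have x0 : 0 < x by rewrite lt_min invr_gt0 ltr0n divr_gt0.
  have x1 : x < 1 by rewrite gt_min invf_lt1 ?ltr1n.
  have xb : 0 < x < 1 by rewrite x0.
  have -> : a = (P * 'X + a%:P).[- rC x] + P.[- rC x] * rC x by rewrite HE subrK.
  apply: le_trans (cnormD _ _) _; rewrite cnormM cnorm_real gtr0_norm //.
  apply: (@le_trans _ _ (A * x + D * x)).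
    apply: lerD; last by rewrite ler_wpM2r ?(ltW x0) // HD.
    apply: le_trans (HP _ xb) _; rewrite ler_wpM2l // exprS ler_piMr ?(ltW x0) //.
    by rewrite exprn_ile1 ?ltW.
  rewrite -mulrDl; apply: (@le_trans _ _ ((A + D + 1) * x)).
    by rewrite ler_wpM2r ?(ltW x0) // lerDl.
  by rewrite mulrC -ler_pdivlMr // ge_min lexx orbT.
case: k => [_|k km]; first by rewrite coefD coefMX coefC /= add0r.
rewrite coefD coefMX coefC /= addr0; apply: IH => // x /andP[x0 x1].
have := HP x; rewrite x0 x1 HE a0 sub0r cnormN cnormM cnorm_real gtr0_norm // => /(_ isT).
by rewrite exprSr mulrA ler_pM2r.
Qed.

Lemma sum_fall_prod_taylor p m B z : \sum_(1 <= n < B) p n * fall_prod n z =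
  \sum_(k < m) (- z) ^+ k * \sum_(1 <= n < B) p n * elem_harm R k n +
  \sum_(1 <= n < B) p n * taylor_rem m n z.
Proof.
under [X in _ = X + _]eq_bigr do rewrite mulr_sumr.
rewrite exchange_big -big_split /=; apply: eq_bigr => n _.
rewrite /taylor_rem mulrBr addrC mulr_sumr.
under [in X in _ = _ - X + _]eq_bigr do rewrite mulrCA.
by rewrite subrK.
Qed.

Lemma good_bounded p T : taylor_good p T -> exists2 A : R, 0 <= A & forall x B, 0 < x < 1 ->
  cnorm (\sum_(1 <= n < B) p n * fall_prod n (rC x)) <= A.
Proof.
move=> [_ /(_ 0%N)[A A0 HA] _]; exists A => // x B xb.
by rewrite (sum_fall_prod_taylor p 0) big_ord0 add0r -[leRHS]mulr1 -(expr0 x) HA.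
Qed.

(** For fixed [x] the truncation [B] goes to infinity first, which removes [product_error]; what
    remains shows that the defect [P] of the Taylor polynomials is [O(x^(m+1))] at [- x], so its
    coefficients up to index [m] vanish. *)
Lemma kawashima_core p p' q K T T' S :
  (forall N, (0 < N)%N -> (\sum_(1 <= j < N.+1) p j * fall_prod j N%:R) * K N =
     \sum_(1 <= j < N.+1) p' j * fall_prod j N%:R) ->
  (forall N, K N = - (N%:R * \sum_(1 <= j < N.+1) q j * fall_prod j N%:R)) ->
  polylog_variation K -> taylor_good p T -> taylor_good p' T' -> taylor_good q S ->
  forall m, \sum_(0 <= k < m) T k * S (m - k).-1 = T' m.
Proof.
move=> HpK HqK [cW [MW MW0 HW]] gp gp' gq m.
have [Bp Bp0 HBp] := good_bounded gp; have [Bq Bq0 HBq] := good_bounded gq.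
have [cvp /(_ m.+1)[Ap Ap0 HAp] [cp [Np Np0 HNp]]] := gp.
have [cvp' /(_ m.+1)[Ap' Ap'0 HAp'] _] := gp'.
have [cvq /(_ m.+1)[Aq Aq0 HAq] _] := gq.
pose PT T := \poly_(k < m.+1) T k : {poly C}.
pose P := PT T * ('X * PT S) - PT T'.
pose A := Bp * Aq + Ap * Bq + Ap * Aq + Ap'.
have A0 : 0 <= A by rewrite !addr_ge0 ?mulr_ge0.
have PTE T0 z : (PT T0).[z] = \sum_(k < m.+1) z ^+ k * T0 k.
  by rewrite horner_poly; apply: eq_bigr => k _; rewrite mulrC.
have cvPT (T0 f : nat -> C) z :
    (forall k, ((fun B => \sum_(1 <= n < B) f n * elem_harm R k n) @ \oo --> T0 k)%classic) ->
    ((fun B => \sum_(k < m.+1) z ^+ k * \sum_(1 <= n < B) f n * elem_harm R k n) @ \oo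
       --> (PT T0).[z])%classic.
  move=> H; rewrite PTE; apply: cvgC_sum; apply/List.Forall_forall => k _.
  exact: (cvgCM (@cvgC_cst R (z ^+ k)) (H k)).
have key x : 0 < x < 1 -> cnorm P.[- rC x] <= A * x ^+ m.+1.
  move=> /[dup] xb /andP[x0 x1]; apply/ler_addgt0Pr => e e0.
  have xb' : 0 <= x <= 1 by rewrite !ltW.
  set z := rC x.
  have NM : 0 < Np * 2 ^+ cp * MW + 1 by rewrite ltr_wpDl // !mulr_ge0 ?exprn_ge0.
  (* The error is at most [hnum B ^+ (cp + cW) * fall_prodR B.+1 x] times [Np * 2 ^+ cp * MW], where
     [2 ^+ cp] passes from [hnum B.+1] to [hnum B]. *)
  have [N HN] := hnumX_fall_prodR_cvg0 (cp + cW) xb (divr_gt0 e0 NM).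
  pose u f B := \sum_(k < m.+1) (- z) ^+ k * \sum_(1 <= n < B) f n * elem_harm R k n.
  apply: (@cnorm_cvg_le _ (fun B => u p B * (- z * u q B) + - 1 * u p' B) _ _ N.+1) => [|[//|B]].
    have -> : P.[- z] = (PT T).[- z] * (- z * (PT S).[- z]) + - 1 * (PT T').[- z].
      by rewrite /P hornerD hornerN !hornerM hornerX mulN1r.
    have c1 := cvPT T p (- z) cvp; have c2 := cvPT S q (- z) cvq.
    have c3 := cvPT T' p' (- z) cvp'.
    exact: (cvgCD (cvgCM c1 (cvgCM (@cvgC_cst R (- z)) c2)) (cvgCM (@cvgC_cst R (- 1)) c3)).
  rewrite ltnS => NB.
  have err := product_error HpK HqK B xb'.
  have Hp := HAp x B.+1 xb; have Hp' := HAp' x B.+1 xb; have Hq := HAq x B.+1 xb.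
  have Gp := HBp x B.+1 xb; have Gq := HBq x B.+1 xb.
  move: err Gp Gq; rewrite !(sum_fall_prod_taylor _ m.+1) -!/(u _ _) -/z.
  set rp := \sum_(1 <= n < B.+1) p n * taylor_rem _ _ _ in Hp *.
  set rq := \sum_(1 <= n < B.+1) q n * taylor_rem _ _ _ in Hq *.
  set rp' := \sum_(1 <= n < B.+1) p' n * taylor_rem _ _ _ in Hp' *.
  move: (u p B.+1) (u q B.+1) (u p' B.+1) => up uq up' err Gp Gq.
  (* Each Taylor polynomial is a Newton sum minus its remainder. The first bracket is the error of
     the product; the other four terms match the four summands of [A]. *)
  have -> : up * (- z * uq) + - 1 * up' =
    ((up + rp) * - (z * (uq + rq)) - (up' + rp')) +
    z * ((up + rp) * rq) + z * (rp * (uq + rq)) - z * (rp * rq) + rp' by ring.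
  have zle (y : C) : cnorm (z * y) <= cnorm y.
    by rewrite cnormM cnorm_real gtr0_norm // ler_piMl ?cnorm_ge0 // ltW.
  have xm : 0 <= x ^+ m.+1 by rewrite exprn_ge0 // ltW.
  have E1 : cnorm (z * ((up + rp) * rq)) <= Bp * Aq * x ^+ m.+1.
    apply: le_trans (zle _) _; rewrite cnormM -mulrA.
    by apply: ler_pM; rewrite ?cnorm_ge0.
  have E2 : cnorm (z * (rp * (uq + rq))) <= Ap * Bq * x ^+ m.+1.
    apply: le_trans (zle _) _; rewrite cnormM mulrAC.
    by apply: ler_pM; rewrite ?cnorm_ge0.
  have E3 : cnorm (z * (rp * rq)) <= Ap * Aq * x ^+ m.+1.
    apply: le_trans (zle _) _; rewrite cnormM -mulrA.
    apply: ler_pM; rewrite ?cnorm_ge0 //.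
      by apply: le_trans Hp _; rewrite ler_piMr // exprn_ile1 // ltW.
  have E0 : cnorm ((up + rp) * - (z * (uq + rq)) - (up' + rp')) <= e.
    apply: le_trans err _.
    have h := HN _ NB; rewrite ltr_pdivlMr // in h.
    apply: le_trans (ltW h); rewrite mulrC.
    have pi0 : 0 <= fall_prodR B.+1 x by have /andP[] := fall_prodR_bounds B.+1 xb'.
    apply: (@le_trans _ _ ((MW * hnum B ^+ cW * fall_prodR B.+1 x) * (Np * (2 ^+ cp *
      hnum B ^+ cp)))).
      apply: ler_pM; rewrite ?mulr_ge0 ?sumr_ge0 //.
      - by move=> i _; exact: variation_term_ge0.
      - by move=> i _; exact: cnorm_ge0.
      - by rewrite ler_wpM2r.
      - by apply: le_trans (HNp _) _; rewrite ler_wpM2l // hnumX_le2.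
    have -> : MW * hnum B ^+ cW * fall_prodR B.+1 x * (Np * (2 ^+ cp * hnum B ^+ cp)) =
       hnum B ^+ (cp + cW) * fall_prodR B.+1 x * (Np * 2 ^+ cp * MW) by rewrite exprD; ring.
    by rewrite ler_wpM2l ?mulr_ge0 ?hnumX_ge0 // lerDl.
  have -> : A * x ^+ m.+1 + e = e + Bp * Aq * x ^+ m.+1 + Ap * Bq * x ^+ m.+1 +
      Ap * Aq * x ^+ m.+1 + Ap' * x ^+ m.+1 by rewrite /A; ring.
  apply: le_trans (cnormD _ _) (lerD _ Hp').
  apply: le_trans (cnormB _ _) (lerD _ E3).
  apply: le_trans (cnormD _ _) (lerD _ E2).
  exact: le_trans (cnormD _ _) (lerD E0 E1).
have := small_poly_coef A0 key (ltnSn m).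
rewrite /P coefB coef_poly ltnSn => /eqP; rewrite subr_eq0 => /eqP <-.
(* The factor ['X] in [P] kills the term [k = m] and shifts the index of [S] to [(m - k).-1]. *)
rewrite coefM big_mkord big_ord_recr /= subnn coefXM /= mulr0 addr0.
apply: eq_bigr => k _; have km := ltn_ord k.
rewrite coefXM subn_eq0 leqNgt km /= !coef_poly.
by rewrite ltnS (ltnW km); have -> : ((m - k).-1 < m.+1)%N by lia.
Qed.

End TaylorCoefficients.

(** * The Euler transform and the map phi *)

Section EulerTransform.
Variable R : realType.
Local Notation F := (Cplx R).
Implicit Types (a b d : nat -> F) (s : F) (n N j : nat).

(* The generating series of [euler a] is [(1 - t)^-1 a(t / (t - 1))]. *)
Definition euler a N : F := \sum_(n < N.+1) (-1) ^+ n * 'C(N, n)%:R * a n.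

(* Coefficients of the product of [a(t)] with [s t / (1 - s t)]. *)
Definition geo_conv s a n : F := \sum_(0 <= j < n) s ^+ (n - j) * a j.

Lemma euler0 a : euler a 0 = a 0%N.
Proof. by rewrite /euler big_ord1 bin0 expr0 !mul1r. Qed.

Lemma eulerD a b N : euler (fun n => a n + b n) N = euler a N + euler b N.
Proof. by rewrite -big_split; apply: eq_bigr => n _; rewrite mulrDr. Qed.

Lemma eulerZ (c : F) a N : euler (fun n => c * a n) N = c * euler a N.
Proof. by rewrite mulr_sumr; apply: eq_bigr => n _; rewrite mulrCA. Qed.

Lemma eulerS a N : euler a N.+1 = euler a N - euler (fun n => a n.+1) N.
Proof.
rewrite /euler big_ord_recl bin0.
under eq_bigr do rewrite lift0 binS natrD mulrDr mulrDl.
rewrite big_split /= big_ord_recr /= bin_small // mulr0 mul0r addr0 addrA; congr (_ + _).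
  by rewrite [in RHS]big_ord_recl bin0; congr (_ + _); apply: eq_bigr => i _; rewrite lift0.
by rewrite -sumrN; apply: eq_bigr => i _; rewrite exprS; ring.
Qed.

Lemma euler_mulnS a N : euler (fun n => n%:R * a n) N.+1 = N.+1%:R * (euler a N.+1 - euler a N).
Proof.
rewrite [euler a N.+1]eulerS addrAC subrr sub0r /euler big_ord_recl mul0r mulr0 add0r mulrN
  mulr_sumr -sumrN.
apply: eq_bigr => i _; rewrite lift0 exprS.
have : i.+1%:R * 'C(N.+1, i.+1)%:R = N.+1%:R * 'C(N, i)%:R :> F.
  by rewrite -!natrM -mul_bin_diag.
move=> H; have -> : -1 * (-1) ^+ i * 'C(N.+1, i.+1)%:R * (i.+1%:R * a i.+1) =
  -1 * (-1) ^+ i * a i.+1 * (i.+1%:R * 'C(N.+1, i.+1)%:R) by ring.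
by rewrite H; ring.
Qed.

Lemma geoS s a n : geo_conv s a n.+1 = s * (geo_conv s a n + a n).
Proof.
rewrite /geo_conv big_nat_recr //= subSnn expr1 mulrDr mulr_sumr; congr (_ + _).
rewrite !big_nat; apply: eq_bigr => i /andP[_ iN].
by rewrite mulrA -exprS subSn // ltnW.
Qed.

Lemma geo0 s a : geo_conv s a 0 = 0.
Proof. by rewrite /geo_conv big_geq. Qed.

Lemma geo1 a n : geo_conv 1 a n = \sum_(0 <= j < n) a j.
Proof. by apply: eq_bigr => j _; rewrite expr1n mul1r. Qed.

Lemma euler_geoS s a N : euler (geo_conv s a) N.+1 =
  (1 - s) * euler (geo_conv s a) N - s * euler a N.
Proof.
rewrite eulerS (_ : euler (fun n => geo_conv s a n.+1) N =
  s * (euler (geo_conv s a) N + euler a N)); first by ring.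
by rewrite -eulerD -eulerZ; apply: eq_bigr => n _; rewrite geoS.
Qed.

(** Multiplication by [n] is [t d/dt]; by [euler_mulnS] it becomes [N] times a backward difference
    after the transform, which telescopes. The summand [j = 0] is zero because [0^-1 = 0]. *)
Lemma euler_antideriv d beta N : d 0%N = 0 ->
  (forall n, euler (fun n => n%:R * d n) n.+1 = beta n.+1) ->
  euler d N = \sum_(0 <= j < N.+1) beta j / j%:R.
Proof.
move=> d0 H; elim: N => [|N IH]; first by rewrite euler0 d0 big_nat1 invr0 mulr0.
rewrite big_nat_recr //= -IH -H euler_mulnS mulrC mulrA mulVf ?pnatr_eq0 // mul1r.
by rewrite addrC subrK.
Qed.

Section Euler.
Variables (a b : nat -> F).
(** In generating series, [b(t) = a(t / (t - 1))]. The lemmas below follow the kernel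
    [s t / (1 - s t)] through this substitution. *)
Hypothesis Hab : forall N, euler a N = \sum_(0 <= j < N.+1) b j.

Lemma euler_geo1 N : euler (geo_conv 1 a) N = - geo_conv 1 b N.
Proof.
case: N => [|N]; first by rewrite euler0 !geo0 oppr0.
by rewrite euler_geoS subrr mul0r sub0r mul1r Hab geo1.
Qed.

Lemma euler_geo1_add N : euler (geo_conv 1 a) N + euler a N = b N.
Proof. by rewrite euler_geo1 Hab geo1 big_nat_recr //= addrA addNr add0r. Qed.

Lemma euler_geo_sub s N : euler (geo_conv s a) N - euler (geo_conv 1 a) N = geo_conv (1 - s) b N.
Proof.
elim: N => [|N IH]; first by rewrite !euler0 !geo0 subrr.
rewrite geoS -IH -euler_geo1_add !euler_geoS; ring.
Qed.

End Euler.

(* The substitution [t / (t - 1)] turns [phi y_s] into the form of [y_(psi_param s)]; the convention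
[delta 0 = 0] is consistent with [psi_param 0 = 1]. *)
Definition psi_param s : F := if s == 1 then 1 else 1 - s.

Lemma psi_param_neq0 s : psi_param s != 0.
Proof. by rewrite /psi_param; case: ifPn; rewrite ?oner_neq0 // subr_eq0 eq_sym. Qed.

(** At integers the Newton basis consists of signed binomial coefficients, which turns the value of
    a Newton series into an Euler transform. *)
Lemma fall_prod_nat_bin n N : (0 < n)%N ->
  N%:R * \prod_(1 <= j < n) (1 - N%:R / j%:R) = - ((-1) ^+ n * 'C(N, n)%:R * n%:R) :> F.
Proof.
elim: n => // -[_ _|n IH _]; first by rewrite big_geq // bin1; ring.
rewrite big_nat_recr //= mulrA IH //.
have n0 : n.+1%:R != 0 :> F by rewrite pnatr_eq0.
have H : 'C(N, n.+2)%:R * n.+2%:R = (N%:R - n.+1%:R) * 'C(N, n.+1)%:R :> F.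
  case: (leqP n.+1 N) => nN.
    by rewrite -natrB // -!natrM mulnC mul_bin_left.
  by rewrite !bin_small // ?mul0r ?mulr0 //; lia.
rewrite -[_ * _ * n.+2%:R]mulrA [_%:R * n.+2%:R]H [in RHS]exprS;
  move: (n.+1%:R : F) n0 => y y0; field; exact: y0.
Qed.

End EulerTransform.

(** * Linear extension and polylogarithm coefficients of words *)

Section Words.
Variable R : realType.
Local Notation C := (Cplx R).
Local Notation word := (word R).
Local Notation zseq := (seq (nat * C)).
Implicit Types (n k m N : nat) (s t c : C) (u v zs : zseq) (w : word).

Definition lin_ext T (f : T -> C) (p : seq (rat * T)) : C := \sum_(t <- p) ratr t.1 * f t.2.

Lemma lin_ext_nil T (f : T -> C) : lin_ext f [::] = 0.
Proof. exact: big_nil. Qed.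

Lemma lin_ext_cons T (f : T -> C) x p : lin_ext f (x :: p) = ratr x.1 * f x.2 + lin_ext f p.
Proof. exact: big_cons. Qed.

Lemma lin_ext_cat T (f : T -> C) p q : lin_ext f (p ++ q) = lin_ext f p + lin_ext f q.
Proof. exact: big_cat. Qed.

Lemma eq_lin_ext T (f g : T -> C) p : f =1 g -> lin_ext f p = lin_ext g p.
Proof. by move=> fg; apply: eq_bigr => x _; rewrite fg. Qed.

Lemma lin_extD T (f g : T -> C) p : lin_ext (fun x => f x + g x) p = lin_ext f p + lin_ext g p.
Proof. by rewrite -big_split; apply: eq_bigr => x _; rewrite mulrDr. Qed.

Lemma lin_extZ T c (f : T -> C) p : lin_ext (fun x => c * f x) p = c * lin_ext f p.
Proof. by rewrite mulr_sumr; apply: eq_bigr => x _; rewrite mulrCA. Qed.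

Lemma lin_ext_sum T I (r : seq I) (f : I -> T -> C) p :
  lin_ext (fun x => \sum_(i <- r) f i x) p = \sum_(i <- r) lin_ext (f i) p.
Proof.
by rewrite exchange_big; apply: eq_bigr => x _; rewrite mulr_sumr.
Qed.

Lemma lin_ext_pscale (f : word -> C) (a : rat) (p : ncpoly R) :
  lin_ext f (pscale a p) = ratr a * lin_ext f p.
Proof.
by rewrite /lin_ext big_map mulr_sumr; apply: eq_bigr => x _; rewrite rmorphM mulrA.
Qed.

Lemma lin_ext_plin (f : word -> C) (g : word -> ncpoly R) p :
  lin_ext f (plin g p) = lin_ext (fun w => lin_ext f (g w)) p.
Proof.
rewrite /plin; elim: p => [|x p IH] /=; first by rewrite !lin_ext_nil.
by rewrite lin_ext_cat lin_ext_cons IH lin_ext_pscale.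
Qed.

Lemma lin_ext_plinw (f : word -> C) g (p : ncpoly R) : lin_ext f (plinw g p) =
  lin_ext (fun w => f (g w)) p.
Proof. by rewrite /lin_ext big_map. Qed.

Lemma lin_ext_pmul (f : word -> C) (p q : ncpoly R) :
  lin_ext f (pmul p q) = lin_ext (fun w => lin_ext (fun w' => f (w ++ w')) q) p.
Proof.
rewrite /pmul; elim: p => [|x p IH] /=; first by rewrite !lin_ext_nil.
rewrite lin_ext_cat lin_ext_cons IH; congr (_ + _).
by rewrite /lin_ext big_map mulr_sumr; apply: eq_bigr => y _; rewrite rmorphM mulrA.
Qed.

Lemma lin_ext_lift_prod (f : word -> C) g (p q : ncpoly R) :
  lin_ext f (lift_prod g p q) =
  lin_ext (fun w => lin_ext (fun w' => lin_ext (fun zs => f (zcomp zs 0)) (g (zdec w).1 (zdec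
    w').1)) q) p.
Proof.
rewrite /lift_prod; elim: p => [|x p IH] /=; first by rewrite !lin_ext_nil.
rewrite flatten_cat lin_ext_cat lin_ext_cons IH; congr (_ + _) => {IH p}.
elim: q => [|y q IH] /=; first by rewrite !lin_ext_nil mulr0.
rewrite lin_ext_cat lin_ext_cons IH mulrDr lin_ext_pscale rmorphM -mulrA; congr (_ * (_ * _) + _).
by rewrite /lin_ext big_map.
Qed.

Lemma lin_ext_zcons (f : zseq -> C) a p : lin_ext f (zcons a p) =
  lin_ext (fun zs => f (a :: zs)) p.
Proof. by rewrite /lin_ext big_map. Qed.

Lemma lin_ext_pword (f : word -> C) w : lin_ext f (pword w) = f w.
Proof. by rewrite /lin_ext big_seq1 rmorph1 mul1r. Qed.

(* Coefficient of [t^n] in the multiple polylogarithm of [w]; for a nonempty word it vanishes at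
[n = 0] because division by zero gives zero. *)
Fixpoint word_coef w n : C :=
  match w with
  | [::] => (n == 0%N)%:R
  | Lx :: w' => word_coef w' n / n%:R
  | Ly s :: w' => geo_conv s (word_coef w') n / n%:R
  end.

Definition psi_letter (a : letter R) : letter R := if a is Ly s then Ly (psi_param s : C) else
  Lx R.

Definition is_y (a : letter R) : bool := if a is Ly _ then true else false.

Definition yend w : bool := if w is a :: w' then is_y (last a w') else true.

Definition phi_coef w n : C := lin_ext (word_coef^~ n) (phi_word w).

Lemma lin_ext_word_coef_x p n : lin_ext (fun w => word_coef (Lx R :: w) n) p =
  lin_ext (word_coef^~ n) p / n%:R.
Proof. by rewrite mulrC -lin_extZ; apply: eq_lin_ext => w /=; rewrite mulrC. Qed.

Lemma lin_ext_word_coef_y s p n : lin_ext (fun w => word_coef (Ly s :: w) n) p =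
  geo_conv s (fun j => lin_ext (word_coef^~ j) p) n / n%:R.
Proof.
rewrite mulrC /geo_conv.
under [X in _ = _ * X]eq_bigr do rewrite -lin_extZ.
rewrite -(lin_ext_sum _ (fun j w => s ^+ (n - j) * word_coef w j)) -lin_extZ.
by apply: eq_lin_ext => w /=; rewrite mulrC.
Qed.

Lemma phi_coef_x w n : phi_coef (Lx R :: w) n = (phi_coef w n + geo_conv 1 (phi_coef w) n) / n%:R.
Proof.
rewrite /phi_coef /= lin_ext_pmul !lin_ext_cons lin_ext_nil addr0 /= !rmorph1 !mul1r
  lin_ext_word_coef_x lin_ext_word_coef_y.
by rewrite -mulrDl.
Qed.

Lemma phi_coef_y s w n : phi_coef (Ly s :: w) n =
  (ratr (delta s) * geo_conv s (phi_coef w) n - geo_conv 1 (phi_coef w) n) / n%:R.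
Proof.
rewrite /phi_coef /= lin_ext_pmul !lin_ext_cons lin_ext_nil addr0 /= rmorphN rmorph1
  !lin_ext_word_coef_y.
by rewrite mulrBl mulrA mulN1r.
Qed.

Lemma phi_coef_cons0 a w : phi_coef (a :: w) 0 = 0.
Proof. by case: a => [|s]; rewrite ?phi_coef_x ?phi_coef_y invr0 mulr0. Qed.

Lemma euler_geo_psi_param (a b : nat ->
  C) s N : (forall N, euler a N = \sum_(0 <= j < N.+1) b j) ->
  ratr (delta s) * euler (geo_conv s a) N - euler (geo_conv 1 a) N = geo_conv (psi_param s) b N.
Proof.
move=> H; rewrite /delta /psi_param; case: (eqVneq s 1) => [_|s1].
  by rewrite orbT rmorph0 mul0r sub0r (euler_geo1 H) opprK.
case: (eqVneq s 0) => [->|s0] /=.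
  by rewrite rmorph0 mul0r sub0r (euler_geo1 H) opprK subr0.
by rewrite rmorph1 mul1r (euler_geo_sub H).
Qed.

(** Induction on the leading letter. The image [x + y_1] of [x] is the form [dt/t + dt/(1 - t)],
    which the substitution sends to [dt/t]; the image of [y_s] is handled by [euler_geo_psi_param].
    A final [x] is excluded because it would divide the constant term by 0. *)
Lemma euler_phi_coef w : yend w ->
  forall N, euler (phi_coef w) N = \sum_(0 <= j < N.+1) word_coef (map psi_letter w) j.
Proof.
elim: w => [_|a w IH]; last first.
  case: a => [|s].
    case: w IH => // a w IH /(IH : is_true (yend (a :: w)) -> _) {}IH N.
    set v := a :: w in IH *.
    apply: (@euler_antideriv _ (phi_coef (Lx R :: v)) (word_coef (map psi_letter v))) => [|n];
      first exact: phi_coef_cons0.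
    rewrite -(euler_geo1_add IH) -eulerD.
    apply: eq_bigr => i _; congr (_ * _); rewrite phi_coef_x -/v addrC.
    (* At index 0 the division cannot be undone, but both sides vanish since [v] is nonempty. *)
    case: (nat_of_ord i) => [|j]; last by rewrite mulrCA mulfV ?mulr1 // pnatr_eq0.
    by rewrite mul0r geo0 add0r phi_coef_cons0.
  move=> H; have {}IH : forall N, euler (phi_coef w) N =
    \sum_(0 <= j < N.+1) word_coef (map psi_letter w) j.
    by apply: IH; case: w H.
  move=> N; apply: (@euler_antideriv _ (phi_coef (Ly s :: w)) (geo_conv (psi_param s)
    (word_coef (map psi_letter w)))) => [|n]; first exact: phi_coef_cons0.
  rewrite -(euler_geo_psi_param _ _ IH) -eulerZ -mulN1r -eulerZ -eulerD.
  apply: eq_bigr => i _; congr (_ * _); rewrite phi_coef_y mulN1r.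
  case: (nat_of_ord i) => [|j]; last by rewrite mulrCA mulfV ?mulr1 // pnatr_eq0.
  by rewrite mul0r !geo0 mulr0 subr0.
move=> N; rewrite /euler big_ord_recl big1 => [|i _].
  rewrite big_nat_recl //= big1 ?addr0 => [|i _]; last by [].
  by rewrite expr0 bin0 !mul1r /phi_coef /= lin_ext_cons lin_ext_nil /= rmorph1 mul1r addr0.
by rewrite /phi_coef /= lin_ext_cons lin_ext_nil /= mulr0 addr0 mulr0.
Qed.

Definition term1_coef s w n : C := (phi_coef w n + ratr (delta s) *
  geo_conv s (phi_coef w) n) / n%:R.

Lemma sum_fall_prod_euler (p : nat -> C) N :
  N%:R * \sum_(1 <= n < N.+1) p n * fall_prod n N%:R = - euler (fun n => n%:R * p n) N.
Proof.
rewrite /euler big_ord_recl mul0r mulr0 add0r big_add1 /= big_mkord mulr_sumr -sumrN.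
apply: eq_bigr => i _; rewrite /bump /= add1n mulrCA /fall_prod fall_prod_nat_bin //; ring.
Qed.

(** With [b] the coefficients of the transformed word, adding and subtracting the kernel of [y_1]
    splits the Euler transform into [b] plus [geo_conv (psi_param s) b]; by [geoS] this is the next
    [geo_conv] divided by [psi_param s]. *)
Lemma term1_coef_nat s a w N (v := a :: w) : yend v ->
  psi_param s * (N%:R * \sum_(1 <= n < N.+1) term1_coef s v n * fall_prod n N%:R) =
  - geo_conv (psi_param s) (word_coef (map psi_letter v)) N.+1.
Proof.
move=> /euler_phi_coef H; rewrite sum_fall_prod_euler geoS -(euler_geo_psi_param _ _ H)
  -(euler_geo1_add H) mulrN.
congr (- (_ * _)).
rewrite addrA subrK addrC -eulerZ -eulerD.
apply: eq_bigr => i _; congr (_ * _); rewrite /term1_coef.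
case: (nat_of_ord i) => [|j]; last by rewrite mulrC divfK // pnatr_eq0.
by rewrite mul0r geo0 mulr0 addr0 phi_coef_cons0.
Qed.

(** * Nested sums of words and the quasi-shuffle product *)

Definition zseq_pos zs := all (fun a : nat * C => (0 < a.1)%N) zs.

Lemma word_coef_nseq k w n : word_coef (nseq k (Lx R) ++ w) n = word_coef w n / n%:R ^+ k.
Proof.
elim: k => [|k IH] /=; first by rewrite expr0 divr1.
by rewrite IH exprSr invfM mulrA.
Qed.

Lemma zcomp_cons k t zs l : zcomp ((k, t) :: zs) l = nseq k.-1 (Lx R) ++ Ly t :: zcomp zs l.
Proof. by rewrite /zcomp /= /zlet /= -catA cat_rcons. Qed.

Lemma word_coef_zcomp k t zs n : (0 < k)%N ->
  word_coef (zcomp ((k, t) :: zs) 0) n = geo_conv t (word_coef (zcomp zs 0)) n / n%:R ^+ k.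
Proof.
move=> k0; rewrite zcomp_cons word_coef_nseq /= -mulrA; congr (_ * _).
by rewrite -invfM -exprS prednK.
Qed.

(** Unfolding a nested sum from outside alternates geometric convolution and division by powers. At
    [n = 0] the empty sequence would give 1 on the left and 0 on the right. *)
Lemma Gsum_geo zs t n : (0 < n)%N -> zseq_pos zs ->
  Gsum zs t n = geo_conv t (word_coef (zcomp zs 0)) n.
Proof.
elim: zs t n => [|[k s] zs IH] t n n0 /=.
  move=> _; case: n n0 => // n _; rewrite /geo_conv big_nat_recl //= subn0 mulr1.
  by rewrite big1 ?addr0 // => i _; rewrite mulr0.
move=> /andP[k0 zp]; rewrite /geo_conv [RHS]big_ltn // word_coef_zcomp // geo0 mul0r mulr0 add0r.
rewrite !big_nat; apply: eq_bigr => m /andP[m0 _].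
by rewrite word_coef_zcomp // IH // [_^-1 * _]mulrC.
Qed.

#[local] Arguments Gsum {R} zs s' m' : simpl never.
#[local] Arguments harmz {R} u v : simpl never.

Definition zseq_map (f : C -> C) zs : zseq := [seq (a.1, f a.2) | a : nat * C <- zs].

(** The cumulative products are taken before [f]. With [f = psi_param] these are the values of
    Newton series at integers, with [f = id] the truncated L-values. *)
Definition Gsum_cum (f : C -> C) s zs n : C := Gsum (zseq_map f (Iz s zs)) (f s) n.

Lemma Gsum_nil s n : Gsum [::] s n = s ^+ n.
Proof. by []. Qed.

Lemma Gsum_cum_cons f s k t zs n : (0 < n)%N -> Gsum_cum f s ((k, t) :: zs) n.+1 =
  f s * (Gsum_cum f s ((k, t) :: zs) n + (n%:R ^+ k)^-1 * Gsum_cum f (s * t) zs n).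
Proof. by move=> n0; rewrite /Gsum_cum /= GsumS. Qed.

Definition zseq_ones zs := all (fun a : nat * C => a.2 == 1) zs.

Lemma Gsum_cum_ones f s zs n : (0 < n)%N -> zseq_ones zs ->
  Gsum_cum f s zs n = f s ^+ n * Gsum zs 1 n.
Proof.
elim: zs n => [|[k t] zs IH] n n0; first by rewrite /Gsum_cum /= !Gsum_nil expr1n mulr1.
move=> /= /andP[/eqP-> zo].
elim: n n0 => // -[_ _|n IHn _]; first by rewrite /Gsum_cum /= !Gsum1 mulr0.
rewrite Gsum_cum_cons // IHn // (@GsumS _ (k, 1) zs 1 n.+1 isT) /= mulr1 IH // mul1r.
by rewrite [f s ^+ n.+2]exprS; ring.
Qed.

Lemma harmz_cons (a b : nat * C) u v : harmz (a :: u) (b :: v) =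
  zcons a (harmz u (b :: v)) ++ zcons b (harmz (a :: u) v)
    ++ zcons ((a.1 + b.1)%N, a.2 * b.2) (harmz u v).
Proof. by []. Qed.

Lemma harmz_nilr u : harmz u [::] = [:: (1, u)] :> zpoly R.
Proof. by case: u. Qed.

(* Since the letters of [v] are [1], inserting them does not change the cumulative products of [u],
so these may be transformed by an arbitrary [f]. *)
Lemma quasi_shuffle f s u v n : (0 < n)%N -> zseq_ones v ->
  lin_ext (fun zs => Gsum_cum f s zs n) (harmz u v) = Gsum_cum f s u n * Gsum v 1 n.
Proof.
elim: u s v n => [|[k t] u IHu] s v n n0 vo.
  by rewrite /lin_ext big_seq1 rmorph1 mul1r Gsum_cum_ones // /Gsum_cum /= Gsum_nil.
elim: v n n0 vo => [|[l t'] v IHv] n n0.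
  by rewrite harmz_nilr /lin_ext big_seq1 rmorph1 mul1r Gsum_nil expr1n mulr1.
move=> /[dup] vo0 /= /andP[/eqP t1 vo]; rewrite {}t1 in vo0 *.
have vo1 : zseq_ones ((l, 1) :: v) by [].
elim: n n0 => // -[_ _|n IHn _].
  have E x zs : Gsum_cum f s (x :: zs) 1 = 0 by rewrite /Gsum_cum /= Gsum1.
  rewrite harmz_cons !lin_ext_cat !lin_ext_zcons.
  by rewrite /lin_ext !big1 ?E ?mul0r ?addr0 // => x _; rewrite E mulr0.
rewrite harmz_cons !lin_ext_cat !lin_ext_zcons /= mulr1.
under eq_lin_ext do rewrite Gsum_cum_cons //.
under [X in _ + (X + _)]eq_lin_ext do rewrite Gsum_cum_cons // mulr1.
under [X in _ + (_ + X)]eq_lin_ext do rewrite Gsum_cum_cons //.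
rewrite !lin_extZ !lin_extD !lin_extZ IHu // IHu // IHv // (@Gsum_cum_cons f s k t u n.+1) //.
rewrite (@GsumS _ (l, 1) v 1 n.+1 isT) /= mul1r.
(* [A1], [A2], [A3] group the product by its first letter at the smaller cutoff, where their sum is
   known by induction; raising the cutoff adds the three terms supplied by the other hypotheses. *)
have := IHn isT; rewrite harmz_cons !lin_ext_cat !lin_ext_zcons /= mulr1.
set A1 := lin_ext _ _; set A2 := lin_ext _ _; set A3 := lin_ext _ _ => H.
have -> : A1 = Gsum_cum f s ((k, t) :: u) n.+1 * Gsum ((l,
  1) :: v) 1 n.+1 - A2 - A3 by rewrite -H; ring.
rewrite /= exprD invfM; ring.
Qed.

End Words.

(** * Multiple L-values of admissible words *)

Section Admissible.
Variable R : realType.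
Local Notation C := (Cplx R).
Local Notation hnum := (hnum R).
Local Notation word := (word R).
Local Notation zseq := (seq (nat * C)).
Implicit Types (n k m j N B c : nat) (s t : C) (u v zs : zseq) (w : word).

#[local] Arguments Gsum {R} zs s' m' : simpl never.
#[local] Arguments harmz {R} u v : simpl never.

Definition unit_zseq zs := all (fun a : nat * C => (0 < a.1)%N && (cnorm a.2 == 1)) zs.

Lemma unit_zseq_pos zs : unit_zseq zs -> zseq_pos zs.
Proof. by apply: sub_all => a /andP[]. Qed.

Lemma cnorm_neq0 t : cnorm t = 1 -> t != 0.
Proof. by move=> t1; rewrite -cnorm_eq0 t1 oner_eq0. Qed.

Lemma Gsum_bound zs t n : cnorm t = 1 -> unit_zseq zs -> cnorm (Gsum zs t n) <= hnum n ^+ size zs.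
Proof.
elim: zs t n => [|[k s] zs IH] t n t1.
  by move=> _; rewrite Gsum_nil cnormX t1 expr1n expr0.
move=> /andP[/andP[/= k0 /eqP s1] ok]; rewrite /Gsum -/(Gsum _ _ _).
apply: le_trans (cnorm_sum _ _ _) _.
apply: (@le_trans _ _ (\sum_(1 <= m < n) hnum n ^+ size zs * m%:R^-1)).
  rewrite !big_nat; apply: ler_sum => m /andP[m0 mn].
  rewrite !cnormM cnormX t1 expr1n mul1r cnormV cnormX cnorm_nat mulrC.
  apply: ler_pM; rewrite ?cnorm_ge0 ?invr_ge0 ?exprn_ge0 //.
    by apply: le_trans (IH _ _ s1 ok) _; rewrite hnumX_mono // ltnW.
  by rewrite lef_pV2 ?posrE ?exprn_gt0 ?ltr0n // ler_eXnr // ler1n.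
rewrite -mulr_sumr exprSr ler_wpM2l ?hnumX_ge0 //.
case: n => [|n]; first by rewrite big_geq // hnum_ge0.
by rewrite big_add1 /= hnumS /hnum [X in _ <= X + _]addrC -addrA lerDl addr_ge0.
Qed.

Lemma Gsum_diff zs t n : (0 < n)%N -> cnorm t = 1 -> unit_zseq zs ->
  cnorm (Gsum zs t n.+1 - t * Gsum zs t n) <= hnum n ^+ size zs / n%:R.
Proof.
move=> n0 t1; case: zs => [|[k s] zs].
  by move=> _; rewrite !Gsum_nil -exprS subrr cnorm0 divr_ge0 ?hnumX_ge0.
move=> /andP[/andP[/= k0 /eqP s1] ok]; rewrite GsumS // mulrDr addrC addKr /=.
rewrite !cnormM t1 mul1r cnormV cnormX cnorm_nat mulrC.
apply: ler_pM; rewrite ?cnorm_ge0 ?invr_ge0 ?exprn_ge0 //.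
  by apply: le_trans (Gsum_bound n s1 ok) _; apply: hnumX_le.
by rewrite lef_pV2 ?posrE ?exprn_gt0 ?ltr0n // ler_eXnr // ler1n.
Qed.

Lemma osc_admissible k t zs : (0 < k)%N -> cnorm t = 1 -> unit_zseq zs -> (1 < k)%N || (t != 1) ->
  exists th c, exists M : R, [/\ th != 1, 0 <= M &
    oscillating th c M (fun n => (n%:R ^+ k)^-1 * Gsum zs t n)].
Proof.
move=> k0 t1 ok adm.
have hs n := hnumX_ge0 R (size zs) n.
have nV n : 0 <= (n%:R : R)^-1 by rewrite invr_ge0.
have le1 M n : 1 <= M -> (0 < n)%N ->
    cnorm ((n%:R ^+ k)^-1 * Gsum zs t n) <= M * (hnum n ^+ size zs / n%:R).
  move=> M1 n0; rewrite cnormM cnormV cnormX cnorm_nat mulrC.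
  rewrite -[leLHS]mul1r; apply: ler_pM => //;
    first by rewrite mulr_ge0 ?cnorm_ge0 ?invr_ge0 ?exprn_ge0.
  apply: ler_pM; rewrite ?cnorm_ge0 ?invr_ge0 ?exprn_ge0 //; first exact: Gsum_bound.
  by rewrite lef_pV2 ?posrE ?exprn_gt0 ?ltr0n // ler_eXnr // ler1n.
have [k1|k1] := leqP k 1; last first.
  (* For [k >= 2] the terms are absolutely summable; the constant pays for replacing [hnum n.+1] by
     [hnum n]. *)
  exists 0, (size zs), (2 ^+ size zs); split; rewrite ?exprn_ge0 //.
    by rewrite eq_sym oner_neq0.
  move=> n n0; split; first by apply: le1; rewrite ?exprn_ege1 ?ler1n.
  rewrite mul0r subr0 cnormM cnormV cnormX cnorm_nat mulrC mulrA.
  apply: ler_pM; rewrite ?cnorm_ge0 ?invr_ge0 ?exprn_ge0 //.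
    by apply: le_trans (Gsum_bound _ t1 ok) _; exact: hnumX_le2.
  rewrite lef_pV2 ?posrE ?exprn_gt0 ?ltr0n //.
  apply: (@le_trans _ _ (n%:R ^+ k)); first by rewrite ler_weXn2l ?ler1n.
  by rewrite lerXn2r ?nnegrE // ler_nat.
have {k0 k1} k1 : k = 1%N by apply/eqP; rewrite eqn_leq k1.
rewrite {}k1 ltnn /= in le1 adm *.
(* For [k = 1] the twisted difference has two parts of equal order, from [Gsum_diff] and from
   [1/n - 1/(n+1)], hence the 2. *)
exists t, (size zs), 2; split=> // n n0; split; first by apply: le1; rewrite ?ler1n.
have nn0 : (n%:R : C) != 0 by rewrite pnatr_eq0 -lt0n.
have n10 : (n.+1%:R : C) != 0 by rewrite pnatr_eq0.
have -> : (n.+1%:R ^+ 1)^-1 * Gsum zs t n.+1 - t * ((n%:R ^+ 1)^-1 * Gsum zs t n) =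
   n.+1%:R^-1 * (Gsum zs t n.+1 - t * Gsum zs t n) - (n%:R * n.+1%:R)^-1 * (t * Gsum zs t n).
  rewrite !expr1 -natr1 in n10 *.
  move: (n%:R : C) nn0 n10 => x x0 x1; field; exact/andP.
have b1 : (n.+1%:R : R)^-1 <= n%:R^-1 by rewrite lef_pV2 ?posrE ?ltr0n // ler_nat.
apply: le_trans (cnormB _ _) _; rewrite mulr2n mulrDl mul1r; apply: lerD.
  rewrite cnormM cnormV cnorm_nat mulrC expr2 invfM mulrA; apply: ler_pM; rewrite ?cnorm_ge0 //.
  exact: Gsum_diff.
rewrite !cnormM t1 mul1r cnormV cnormM !cnorm_nat mulrC; apply: ler_pM;
  rewrite ?cnorm_ge0 ?invr_ge0 ?mulr_ge0 //.
  exact: Gsum_bound.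
by rewrite expr2 !invfM ler_wpM2l.
Qed.

Lemma all_Forall T (a : pred T) (P : T -> Prop) (p : seq T) :
  all a p -> (forall x, a x -> P x) -> List.Forall P p.
Proof.
move=> + aP; elim: p => [_|x p IH /= /andP[ax /IH]]; first exact: List.Forall_nil.
by move=> H; apply: List.Forall_cons => //; exact: aP.
Qed.

Lemma eq_lin_ext_Forall T (f g : T -> C) (p : seq (rat * T)) :
  List.Forall (fun x => f x.2 = g x.2) p -> lin_ext f p = lin_ext g p.
Proof.
by elim: p => [|x p IH] H; rewrite ?lin_ext_nil // !lin_ext_cons (List.Forall_inv H)
  (IH (List.Forall_inv_tail H)).
Qed.

Lemma harmz_all (P : pred (nat * C)) u v :
  (forall a b, P a -> P b -> P ((a.1 + b.1)%N, a.2 * b.2)) ->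
  all P u -> all P v -> all (fun x => all P x.2) (harmz u v).
Proof.
move=> HP; elim: u v => [|a u IHu] v; first by rewrite /harmz /= => _ ->.
move=> /[dup] Pau /= /andP[Pa Pu]; elim: v => [|b v IHv]; first by rewrite harmz_nilr /= Pa Pu.
move=> /[dup] Pbv /= /andP[Pb Pv]; rewrite harmz_cons !all_cat !all_map /=.
apply/and3P; split.
- by apply: sub_all (IHu _ Pu Pbv) => x /= ->; rewrite Pa.
- by apply: sub_all (IHv Pv) => x /= ->; rewrite Pb.
by apply: sub_all (IHu _ Pu Pv) => x /= ->; rewrite HP.
Qed.

Lemma harmz_nonnil a u v : all (fun x => ~~ nilp x.2) (harmz (a :: u) v).
Proof.
case: v => [|b v]; first by rewrite harmz_nilr.
by rewrite harmz_cons !all_cat !all_map; apply/and3P; split; apply/all_predT.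
Qed.

Lemma unit_zseq_mul (a b : nat * C) : (0 < a.1)%N && (cnorm a.2 == 1) ->
  (0 < b.1)%N && (cnorm b.2 == 1) -> (0 < a.1 + b.1)%N && (cnorm (a.2 * b.2) == 1).
Proof.
by move=> /andP[a0 /eqP a1] /andP[b0 /eqP b1]; rewrite addn_gt0 a0 cnormM a1 b1 mulr1 /=.
Qed.

Lemma unit_zseq_Iz s zs : cnorm s = 1 -> unit_zseq zs -> unit_zseq (Iz s zs).
Proof.
elim: zs s => // -[k t] zs IH s s1 /= /andP[/andP[/= k0 /eqP t1] ok].
have st : cnorm (s * t) = 1 by rewrite cnormM s1 t1 mulr1.
by rewrite k0 st eqxx /= IH.
Qed.

Lemma unit_zseq_Iinvz s zs : cnorm s = 1 -> unit_zseq zs -> unit_zseq (Iinvz s zs).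
Proof.
elim: zs s => // -[k t] zs IH s s1 /= /andP[/andP[/= k0 /eqP t1] ok].
by rewrite k0 cnormM cnormV t1 s1 invr1 mulr1 eqxx /= IH.
Qed.

Lemma Iz_Iinvz s zs : cnorm s = 1 -> unit_zseq zs -> Iz s (Iinvz s zs) = zs.
Proof.
elim: zs s => // -[k t] zs IH s s1 /= /andP[/andP[/= k0 /eqP t1] ok].
by rewrite mulrC divfK ?cnorm_neq0 // IH.
Qed.

Lemma unit_zseq_nseq j : unit_zseq (nseq j (1%N, 1)).
Proof. by apply/allP => a /nseqP[-> _] /=; apply/eqP; exact: cnorm1. Qed.

Lemma zseq_ones_nseq j : zseq_ones (nseq j (1%N, 1 : C)).
Proof. by rewrite /zseq_ones all_nseq /= eqxx orbT. Qed.

Lemma zseq_map_id zs : zseq_map id zs = zs.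
Proof. by rewrite /zseq_map; elim: zs => //= -[k t] zs ->. Qed.

(** * Decomposition of words into the letters [z_(k,s)] *)

Lemma zdec_aux_nseq c k w : zdec_aux c (nseq k (Lx R) ++ w) = zdec_aux (c + k) w.
Proof. by elim: k c => [|k IH] c /=; rewrite ?addn0 // IH addSnnS. Qed.

Lemma zdec_zcomp zs : zseq_pos zs -> zdec (zcomp zs 0) = (zs, 0%N).
Proof.
rewrite /zdec; elim: zs => // -[k t] zs IH /= /andP[/= k0 zp].
by rewrite zcomp_cons zdec_aux_nseq /= IH // add0n prednK.
Qed.

Lemma zcomp_zdec_aux c w :
  zcomp (zdec_aux c w).1 (zdec_aux c w).2 = nseq c (Lx R) ++ w.
Proof.
elim: w c => [|[|s] w IH] c /=; first by rewrite cats0.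
  by rewrite IH; elim: c => //= c ->.
by have := IH 0%N; case: (zdec_aux 0 w) => zs l /= E; rewrite zcomp_cons E.
Qed.

Lemma zdec_aux_pos c w : all (fun a : nat * C => (0 < a.1)%N) (zdec_aux c w).1.
Proof.
elim: w c => [|[|s] w IH] c //=.
by have := IH 0%N; case: (zdec_aux 0 w).
Qed.

Definition letterP (P : pred C) (a : letter R) : bool := if a is Ly s then P s else true.

Lemma zdec_aux_letters (P : pred C) c w :
  all (letterP P) w -> all (fun a : nat * C => P a.2) (zdec_aux c w).1.
Proof.
elim: w c => [|[|s] w IH] c //=; first exact: IH.
by move=> /andP[Ps /(IH 0%N)]; case: (zdec_aux 0 w) => zs l /= ->; rewrite Ps.
Qed.

Lemma yend_consy s w : yend (Ly s :: w) -> yend w.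
Proof. by case: w. Qed.

Lemma zdec_aux_yend c w : yend w -> (zdec_aux c w).2 = if nilp w then c else 0%N.
Proof.
elim: w c => [|[|s] w IH] c //=.
  by case: w IH => // a w IH H; rewrite (IH c.+1 H).
move=> /(yend_consy (s := s))/IH => /(_ 0%N).
by case: (zdec_aux 0 w) => zs l /= ->; case: nilp.
Qed.

(** With [c = 1] it shows that a word starting with [x] has first exponent at least 2, hence is
    admissible. *)
Lemma zdec_aux_head c w k t zs : (zdec_aux c w).1 = (k, t) :: zs -> (c < k)%N.
Proof.
elim: w c => [|[|s] w IH] c //=; first by move=> /IH/ltnW.
by case: (zdec_aux 0 w) => zs' l /= [<- _ _].
Qed.

Lemma zcomp_zdec w : yend w -> zcomp (zdec w).1 0 = w.
Proof.
move=> yw; have := zcomp_zdec_aux 0 w; rewrite (zdec_aux_yend 0 yw).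
by case: nilp.
Qed.

Definition unit_letter : pred C := fun s => cnorm s == 1.
Definition one_letter : pred C := fun s => s == 1.

Lemma unit_zseq_zdec w : all (letterP unit_letter) w -> unit_zseq (zdec w).1.
Proof.
move=> /(zdec_aux_letters 0%N) H; rewrite -/(zdec w) in H.
have := zdec_aux_pos 0 w; rewrite -/(zdec w) => H'.
by apply/allP => a az; rewrite (allP H' _ az); exact: (allP H _ az).
Qed.

(** The sum of the coefficients of [z_(k,t) v] weighted by [e_j(n)], expressed in L-values. Ratios
    are taken relative to the head [t], since the harmonic product acts on the tail only. *)
Definition Lsh_admissible k t v j : C := lin_ext (fun z => Lsh_word (zcomp ((k, t) :: Iz t z) 0))
  (harmz (Iinvz t v) (nseq j (1%N, 1))).

Lemma good_eq (p p' : nat -> C) T :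
  (forall n, (0 < n)%N -> p n = p' n) -> taylor_good p T -> taylor_good p' T.
Proof.
move=> pp' [h1 h2 h3].
have E (X : C -> nat -> C) B :
    \sum_(1 <= n < B) X (p n) n = \sum_(1 <= n < B) X (p' n) n.
  by rewrite !big_nat; apply: eq_bigr => n /andP[n0 _]; rewrite pp'.
split=> [k|m|].
- under eq_fun do rewrite -(E (fun a n => a * elem_harm R k n)).
  exact: h1.
- have [A A0 H] := h2 m; exists A => // x B xb.
  by rewrite -(E (fun a n => a * taylor_rem m n _)) H.
have [c [A A0 H]] := h3; exists c, A => // B.
rewrite big_nat; under eq_bigr => i /andP[i0 _] do rewrite -pp' //.
by rewrite -big_nat.
Qed.

Lemma Gsum_one k t zs B : @Gsum R ((k, t) :: zs) 1 B =
  \sum_(1 <= n < B) (n%:R ^+ k)^-1 * Gsum zs t n.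
Proof. by apply: eq_bigr => n _; rewrite expr1n mul1r. Qed.

Lemma Lsh_word_cvg k t zs : (0 < k)%N -> cnorm t = 1 -> unit_zseq zs -> (1 < k)%N || (t != 1) ->
  ((fun B => \sum_(1 <= n < B) (n%:R ^+ k)^-1 * Gsum zs t n) @ \oo -->
     Lsh_word (zcomp ((k, t) :: zs) 0))%classic.
Proof.
move=> k0 t1 ok adm.
have [th [c [M [th1 M0 H]]]] := osc_admissible k0 t1 ok adm.
have [l Hl] := osc_sum_cvg th1 M0 H.
suff -> : Lsh_word (zcomp ((k, t) :: zs) 0) = l by [].
rewrite /Lsh_word zdec_zcomp; last by rewrite /= k0 unit_zseq_pos.
by apply: limC; under eq_fun do rewrite /= Gsum_one.
Qed.

(** By [quasi_shuffle] with [f = id], the inner nested sum times [elem_harm] is a finite combination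
    of nested sums, so each weighted series converges to a combination of L-values. *)
Lemma good_Lsh_admissible k t v : (0 < k)%N -> cnorm t = 1 -> unit_zseq v ->
  (1 < k)%N || (t != 1) ->
  taylor_good (word_coef (zcomp ((k, t) :: v) 0)) (Lsh_admissible k t v).
Proof.
move=> k0 t1 ok adm.
have [th [c [M [th1 M0 H]]]] := osc_admissible k0 t1 ok adm.
apply: (@good_eq (fun n => (n%:R ^+ k)^-1 * Gsum v t n)).
  by move=> n n0; rewrite word_coef_zcomp // mulrC Gsum_geo // unit_zseq_pos.
apply: osc_good th1 M0 H _ => j.
have E B : \sum_(1 <= n < B) (n%:R ^+ k)^-1 * Gsum v t n * elem_harm R j n =
   lin_ext (fun z => \sum_(1 <= n < B) (n%:R ^+ k)^-1 * Gsum (Iz t z) t n)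
     (harmz (Iinvz t v) (nseq j (1%N, 1))).
  rewrite lin_ext_sum !big_nat; apply: eq_bigr => n /andP[n0 _]; rewrite lin_extZ -mulrA;
    congr (_ * _).
  have := quasi_shuffle id t (Iinvz t v) n0 (zseq_ones_nseq j).
  by rewrite /Gsum_cum zseq_map_id Iz_Iinvz //; under eq_lin_ext do rewrite zseq_map_id.
under eq_fun do rewrite E.
apply: cvgC_sum; apply: (@all_Forall _ (fun x => unit_zseq x.2)).
  by apply: harmz_all; [exact: unit_zseq_mul|exact: unit_zseq_Iinvz|exact: unit_zseq_nseq].
move=> x okx; apply: cvgCM; first exact: cvgC_cst.
by apply: Lsh_word_cvg => //; exact: unit_zseq_Iz.
Qed.

Definition Lsh_tail w : C := lin_ext (@Lsh_word R) (Lxinv_word w).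

Lemma Lsh_tail_zcomp k t zs : (0 < k)%N ->
  Lsh_tail (zcomp ((k.+1, t) :: zs) 0) = Lsh_word (zcomp ((k, t) :: zs) 0).
Proof. by case: k => // k _; rewrite /Lsh_tail !zcomp_cons /= lin_ext_pword. Qed.

Lemma zdec_y1 j : zdec (nseq j (Ly (1 : C))) = (nseq j (1%N, 1), 0%N).
Proof.
rewrite -[RHS]zdec_zcomp; last by rewrite /zseq_pos all_nseq orbT.
by congr zdec; elim: j => // j IH; rewrite [nseq j.+1 (_, _)]/= zcomp_cons -IH.
Qed.

Definition term1_Lsh j w : C := lin_ext (fun z => Lsh_tail (Iw (zcomp z 0)))
  (dotharmz (zdec (Iinvw w)).1 (zdec (nseq j.+1 (Ly 1))).1).

Definition term2_Lsh j w : C := lin_ext (fun z => Lsh_tail (zcomp z 0))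
  (dotharmz (zdec w).1 (zdec (nseq j.+1 (Ly 1))).1).

Lemma Iw_zcomp zs : zseq_pos zs -> Iw (zcomp zs 0) = zcomp (Iz 1 zs) 0.
Proof. by move=> zp; rewrite /Iw zdec_zcomp. Qed.

Lemma zseq_pos_Iinvz s zs : zseq_pos zs -> zseq_pos (Iinvz s zs).
Proof. by elim: zs s => // a zs IH s /= /andP[-> zp]; exact: IH. Qed.

Lemma zseq_pos_Iz s zs : zseq_pos zs -> zseq_pos (Iz s zs).
Proof. by elim: zs s => // a zs IH s /= /andP[-> zp]; exact: IH. Qed.

(** The dotted product uses one [y_1] to raise the first exponent and shuffles the other [j] into
    the tail; removing the leading [x] restores the exponent [k]. *)
Lemma term1_Lsh_zcomp k t v j : (0 < k)%N -> zseq_pos v ->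
  term1_Lsh j (zcomp ((k, t) :: v) 0) = Lsh_admissible k t v j.
Proof.
move=> k0 zp; have zpa : zseq_pos ((k, t) :: v) by rewrite /= k0.
rewrite /term1_Lsh /Iinvw zdec_zcomp // zdec_zcomp; last exact: (zseq_pos_Iinvz 1 zpa).
rewrite zdec_y1 /= divr1 mulr1 lin_ext_zcons; apply: eq_lin_ext_Forall.
apply: (@all_Forall _ (fun x => zseq_pos x.2)).
  apply: harmz_all; [|exact: zseq_pos_Iinvz|by rewrite /zseq_pos all_nseq orbT].
  by move=> a b a0 b0; rewrite addn_gt0 a0.
move=> x zx; rewrite Iw_zcomp; last by rewrite /= addn1.
by rewrite /= mul1r addn1 Lsh_tail_zcomp.
Qed.

Lemma Iinvz_ones zs : zseq_ones zs -> Iinvz 1 zs = zs.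
Proof.
by elim: zs => // -[k t] zs IH /= /andP[/eqP /= -> /IH ->]; rewrite divr1.
Qed.

Lemma Iz_ones zs : zseq_ones zs -> Iz 1 zs = zs.
Proof.
by elim: zs => // -[k t] zs IH /= /andP[/eqP /= -> /IH]; rewrite mul1r => ->.
Qed.

Lemma term2_Lsh_zcomp k v j : (0 < k)%N -> zseq_pos v -> zseq_ones v ->
  term2_Lsh j (zcomp ((k, 1) :: v) 0) = Lsh_admissible k 1 v j.
Proof.
move=> k0 zp zo; have zpa : zseq_pos ((k, 1) :: v) by rewrite /= k0.
rewrite /term2_Lsh zdec_zcomp // zdec_y1 /= mulr1 lin_ext_zcons /Lsh_admissible Iinvz_ones //.
apply: eq_lin_ext_Forall; apply: (@all_Forall _ (fun x => zseq_ones x.2)).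
  apply: harmz_all => //; last exact: zseq_ones_nseq.
  by move=> a b /eqP -> /eqP ->; rewrite mulr1.
by move=> x zx; rewrite addn1 Lsh_tail_zcomp // Iz_ones.
Qed.

Lemma zdec_cons w : yend w -> ~~ nilp w -> exists k t v, [/\ (zdec w).1 = (k, t) :: v,
  (0 < k)%N, zseq_pos v & w = zcomp ((k, t) :: v) 0].
Proof.
move=> yw nw; have := zdec_aux_pos 0 w; have := zcomp_zdec yw; rewrite -/(zdec w).
case: (zdec w).1 => [|[k t] v] E; first by rewrite -E in nw.
by move=> /= /andP[k0 zp]; exists k, t, v.
Qed.

Lemma good_term1_Lsh a w (y := a :: w) : yend y -> all (letterP unit_letter) y ->
  (if a is Ly s then s != 1 else true) -> taylor_good (word_coef y) (term1_Lsh^~ y).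
Proof.
move=> yy uy ha; have [k [t [v [E k0 zp yE]]]] := zdec_cons yy isT.
have := unit_zseq_zdec uy; rewrite E => /andP[/andP[_ /eqP t1] ok].
rewrite yE (_ : term1_Lsh^~ _ = Lsh_admissible k t v).
  apply: good_Lsh_admissible => //; move: E ha; rewrite /y; case: (a) => [|s] /=.
    by rewrite /zdec /= => /zdec_aux_head ->.
  by rewrite /zdec /=; case: (zdec_aux 0 w) => zs l /= [_ <- _] ->; rewrite orbT.
by apply/funext => j; rewrite term1_Lsh_zcomp.
Qed.

Lemma good_term2_Lsh w (y := Lx R :: w) : yend y -> all (letterP one_letter) y ->
  taylor_good (word_coef y) (term2_Lsh^~ y).
Proof.
move=> yy oy; have [k [t [v [E k0 zp yE]]]] := zdec_cons yy isT.
have : zseq_ones (zdec y).1 := zdec_aux_letters 0 oy.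
rewrite E => /andP[/eqP t1' zo]; have t1 : t = 1 := t1'; rewrite {}t1 in E yE.
have uy : all (letterP unit_letter) y.
  apply: sub_all oy => -[|s] //= /eqP ->; apply/eqP; exact: cnorm1.
have := unit_zseq_zdec uy; rewrite E => /andP[_ ok].
rewrite yE (_ : term2_Lsh^~ _ = Lsh_admissible k 1 v).
  apply: good_Lsh_admissible => //; first exact: cnorm1.
  by move: E; rewrite /zdec /= => /zdec_aux_head ->.
by apply/funext => j; rewrite term2_Lsh_zcomp.
Qed.

(** Emptiness is recorded so that an [x] put in front of a term of [phi_word w], for nonempty [w],
    never becomes the final letter. *)
Definition tailok (P : pred C) w w' :=
  [&& all (letterP P) w', yend w' & nilp w' == nilp w].

Lemma phi_word_all (P : pred C) w : P 1 -> all (letterP P) w -> yend w ->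
  all (fun x => tailok P w x.2) (phi_word w).
Proof.
move=> P1; elim: w => // a w IH /= /andP[Pa Pw] yw.
have yw' : yend w by case: (w) yw.
have {}IH := IH Pw yw'.
have H (c : rat) (b : letter R) : letterP P b -> (is_y b || ~~ nilp w) ->
    all (fun x => tailok P (a :: w) x.2) [seq (c * x.1, b :: x.2) | x <- phi_word w].
  move=> Pb yb; rewrite all_map; apply: sub_all IH => -[d w'] /= /and3P[/= Pw' yw2 /eqP nw'].
  rewrite /tailok /= Pb Pw' /= andbT; move: yb; rewrite -nw'.
  by case: (w') yw2 => //=; rewrite orbF.
have ya : is_y a || ~~ nilp w by case: (w) yw => [/= ->|b u _] //; rewrite orbT.
case: a Pa ya yw H => [|s] /= Pa ya yw H; rewrite /pmul /= cats0 all_cat; apply/andP; split;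
  by apply: H.
Qed.

Definition term1_word s k w : C := lin_ext (fun u : word => term1_Lsh k (Lx R :: u)) (phi_word
  w) +
  ratr (delta s) * lin_ext (fun u : word => term1_Lsh k (Ly s :: u)) (phi_word w).

Definition term2_word j w : C := lin_ext (fun u : word => term2_Lsh j (Lx R :: u)) (phi_word w).

Lemma good_term1_word s w : cnorm s = 1 -> all (letterP unit_letter) w -> yend w -> ~~ nilp w ->
  taylor_good (term1_coef s w) (fun k => term1_word s k w).
Proof.
move=> s1 uw yw nw.
have u1 : unit_letter 1 by apply/eqP; exact: cnorm1.
have HF := phi_word_all u1 uw yw.
apply: (@good_eq (fun n => lin_ext (fun u : word => word_coef (Lx R :: u) n) (phi_word w) +
    ratr (delta s) * lin_ext (fun u : word => word_coef (Ly s :: u) n) (phi_word w))).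
  by move=> n _; rewrite lin_ext_word_coef_x lin_ext_word_coef_y /term1_coef mulrDl mulrA.
apply: goodD.
  apply: good_sum; apply: (all_Forall HF) => x /and3P[ux yx /eqP nx]; right.
  apply: good_term1_Lsh => //=.
  by move: nx yx; case: (x.2) => //=; rewrite (negbTE nw).
(* For [s = 1] the words starting with [y_1] may diverge, but their coefficient [delta 1] is 0. *)
case: (eqVneq s 1) => [s_1|sn1].
  rewrite /delta s_1 eqxx orbT rmorph0.
  under eq_fun do rewrite mul0r; under [X in taylor_good _ X]eq_fun do rewrite mul0r.
  exact: good0.
apply: goodZ; apply: good_sum; apply: (all_Forall HF) => x /and3P[ux yx /eqP nx]; right.
apply: good_term1_Lsh => //=; last by rewrite /unit_letter s1 eqxx.
by move: nx yx; case: (x.2) => //=; rewrite (negbTE nw).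
Qed.

Lemma good_term2_word w : all (letterP one_letter) w -> yend w -> ~~ nilp w ->
  taylor_good (fun n => phi_coef w n / n%:R) (term2_word^~ w).
Proof.
move=> uw yw nw; have HF := phi_word_all (eqxx 1 : one_letter 1) uw yw.
apply: (@good_eq (fun n => lin_ext (fun u : word => word_coef (Lx R :: u) n) (phi_word w))).
  by move=> n _; rewrite lin_ext_word_coef_x.
apply: good_sum; apply: (all_Forall HF) => x /and3P[ux yx /eqP nx]; right.
apply: good_term2_Lsh => //=.
by move: nx yx; case: (x.2) => //=; rewrite (negbTE nw).
Qed.

(** * From the word identity to the bilinear relation *)

Lemma lin_ext_Lxinv (p : ncpoly R) : Lsh (Lxinv p) = lin_ext Lsh_tail p.
Proof. by rewrite -[LHS]/(lin_ext _ _) lin_ext_plin. Qed.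

Lemma Lsh_term1 s (p : ncpoly R) k :
  Lsh (term1 s p k) = lin_ext (fun w => term1_word s k (Iw (Mw s w))) p.
Proof.
rewrite /term1 lin_ext_Lxinv lin_ext_plinw lin_ext_lift_prod lin_ext_plinw.
under eq_lin_ext do rewrite lin_ext_pword.
rewrite lin_ext_pmul !lin_ext_cons lin_ext_nil addr0 rmorph1 mul1r !lin_ext_plin !lin_ext_plinw
  -lin_extZ -lin_extD.
by apply: eq_lin_ext => w.
Qed.

Lemma Lsh_term2 (p : ncpoly R) l : (0 < l)%N -> Lsh (term2 p l) = lin_ext (term2_word l.-1) p.
Proof.
move=> l0; rewrite /term2 lin_ext_Lxinv lin_ext_lift_prod.
under eq_lin_ext do rewrite lin_ext_pword.
rewrite lin_ext_pmul lin_ext_pword lin_ext_plin; apply: eq_lin_ext => w; apply: eq_lin_ext => u.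
by rewrite /term2_Lsh prednK.
Qed.

Lemma Iw_Mw s zs : zseq_pos zs -> Iw (Mw s (zcomp zs 0)) = zcomp (Iz s zs) 0.
Proof.
move=> zp; rewrite /Mw zdec_zcomp // Iw_zcomp; last by case: zs zp.
by case: zs zp => // -[k t] zs zp /=; rewrite mul1r.
Qed.

Lemma yend_zcomp zs : yend (zcomp zs 0).
Proof.
elim: zs => // -[k t] zs IH; rewrite zcomp_cons.
elim: k.-1 => [|n IHn] /=; last by case: n IHn.
by move: IH; case: (zcomp zs 0).
Qed.

Lemma letters_zcomp (P : pred C) zs :
  all (fun a : nat * C => P a.2) zs -> all (letterP P) (zcomp zs 0).
Proof.
elim: zs => // -[k t] zs IH /= /andP[Pt /IH H].
by rewrite zcomp_cons all_cat /= Pt H all_nseq orbT.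
Qed.

Lemma zcomp_nonnil zs : ~~ nilp zs -> ~~ nilp (zcomp zs 0).
Proof. by case: zs => // -[k t] zs _; rewrite zcomp_cons; case: k.-1. Qed.

Lemma psi_zcomp zs : map (@psi_letter R) (zcomp zs 0) = zcomp (zseq_map (@psi_param R) zs) 0.
Proof.
elim: zs => // -[k t] zs IH.
by rewrite [zseq_map _ _]/= !zcomp_cons map_cat map_nseq /= IH.
Qed.

Lemma psi_ones w : all (letterP one_letter) w -> map (@psi_letter R) w = w.
Proof.
elim: w => // a w IH /= /andP[Ha /IH ->].
by case: a Ha => //= s /eqP->; rewrite /psi_param eqxx.
Qed.

Lemma term1_coef_Gsum_cum s zs N : zseq_pos zs -> ~~ nilp zs ->
  psi_param s * (N%:R * \sum_(1 <= n < N.+1) term1_coef s (zcomp (Iz s zs) 0) n *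
    fall_prod n N%:R) =
  - Gsum_cum (@psi_param R) s zs N.+1.
Proof.
move=> zp nz; have := zcomp_nonnil (zs := Iz s zs).
have := yend_zcomp (Iz s zs); have := psi_zcomp (Iz s zs).
have -> : ~~ nilp (Iz s zs) by case: (zs) nz.
case E : (zcomp (Iz s zs) 0) => [|a w]; first by move=> _ _ /(_ isT).
move=> Ep yw _; rewrite term1_coef_nat // Ep /Gsum_cum Gsum_geo //.
by move: (zseq_pos_Iz s zp); rewrite /zseq_pos /zseq_map all_map.
Qed.

(** An instance of [kawashima_core] in which [K] is the truncated multiple harmonic sum of [w'],
    interpolated by the Newton series with coefficients [phi_coef w' n / n]. *)
Lemma word_identity s w w' m : cnorm s = 1 ->
  all (letterP unit_letter) w -> yend w -> ~~ nilp w ->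
  all (letterP one_letter) w' -> yend w' -> ~~ nilp w' ->
  \sum_(0 <= k < m) term1_word s k (Iw (Mw s w)) * term2_word (m - k).-1 w' =
  lin_ext (fun z => term1_word s m (Iw (Mw s (zcomp z 0)))) (harmz (zdec w).1 (zdec w').1).
Proof.
move=> s1 uw yw nw ow yw' nw'.
have okw := unit_zseq_zdec uw; have zo : zseq_ones (zdec w').1 := zdec_aux_letters 0 ow.
have zp' : zseq_pos (zdec w').1 := zdec_aux_pos 0 w'.
have okw' : unit_zseq (zdec w').1.
  apply/allP => a az; rewrite (allP zp' _ az) (eqP (allP zo _ az)); apply/eqP; exact: cnorm1.
have [k [t [v [E _ _ wE]]]] := zdec_cons yw nw.
have nz : ~~ nilp (zdec w).1 by rewrite E.
have Hz : all (fun x => unit_zseq x.2 && ~~ nilp x.2) (harmz (zdec w).1 (zdec w').1).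
  rewrite all_predI (harmz_all unit_zseq_mul) //= E; exact: harmz_nonnil.
have good_z zs : unit_zseq zs -> ~~ nilp zs ->
    taylor_good (term1_coef s (zcomp (Iz s zs) 0)) (fun k => term1_word s k (Iw (Mw s (zcomp zs
      0)))).
  move=> ok nzs; rewrite Iw_Mw ?unit_zseq_pos //; apply: good_term1_word => //.
  - apply: letters_zcomp; apply: sub_all (unit_zseq_Iz s1 ok) => a /andP[_]; exact.
  - exact: yend_zcomp.
  by apply: zcomp_nonnil; case: (zs) nzs.
set zs := (zdec w).1 in okw nz Hz *; set zs' := (zdec w').1 in zo zp' okw' Hz *.
have <- : zcomp zs 0 = w by exact: zcomp_zdec.
apply: (@kawashima_core R (term1_coef s (zcomp (Iz s zs) 0))
   (fun n => lin_ext (fun z => term1_coef s (zcomp (Iz s z) 0) n) (harmz zs zs'))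
   (fun n => phi_coef w' n / n%:R) (fun N => Gsum zs' 1 N.+1)
   (fun k => term1_word s k (Iw (Mw s (zcomp zs 0))))
   (fun k => lin_ext (fun z => term1_word s k (Iw (Mw s (zcomp z 0)))) (harmz zs zs'))
   (term2_word^~ w')).
- move=> N N0; have N0' : (N%:R : C) != 0 by rewrite pnatr_eq0 -lt0n.
  (* With this nonzero factor both Newton series become nested sums by [term1_coef_Gsum_cum], and
     the claim is [quasi_shuffle] for [f = psi_param]. *)
  apply: (mulfI (mulf_neq0 (psi_param_neq0 s) N0')).
  rewrite mulrA -[X in X * _]mulrA term1_coef_Gsum_cum ?unit_zseq_pos // mulNr.
  rewrite -(quasi_shuffle _ _ _ _ zo) //.
  have -> : \sum_(1 <= j < N.+1) lin_ext (fun z => term1_coef s (zcomp (Iz s z) 0) j) (harmz zs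
    zs') * fall_prod j N%:R
    = lin_ext (fun z => \sum_(1 <= j < N.+1) term1_coef s (zcomp (Iz s z) 0) j *
      fall_prod j N%:R) (harmz zs zs').
    by rewrite lin_ext_sum; apply: eq_bigr => j _; rewrite [LHS]mulrC -lin_extZ;
      apply: eq_lin_ext => z; rewrite mulrC.
  rewrite -lin_extZ -mulN1r -lin_extZ; apply: eq_lin_ext_Forall;
    apply: (all_Forall Hz) => x /andP[okx nx].
  by rewrite -mulrA term1_coef_Gsum_cum ?unit_zseq_pos // mulN1r.
- move=> N; rewrite sum_fall_prod_euler opprK.
  have -> : euler (fun n => n%:R * (phi_coef w' n / n%:R)) N = euler (phi_coef w') N.
    apply: eq_bigr => i _; congr (_ * _).
    case: (nat_of_ord i) => [|j]; last by rewrite mulrC divfK // pnatr_eq0.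
    by rewrite mul0r; case: (w') nw' => // a u _; rewrite phi_coef_cons0.
  (* All roots of unity in [w'] are 1 and [psi_param 1 = 1], so the Euler transform returns the
     harmonic sum of [w'] itself. *)
  rewrite (euler_phi_coef yw') psi_ones // -geo1 Gsum_geo // /zs' zcomp_zdec //.
- by apply: polylog_variation_Gsum; apply/allP => a az; rewrite (allP zp' _ az);
  exact: (allP zo _ az).
- exact: good_z.
- apply: good_sum; apply: (all_Forall Hz) => x /andP[okx nx]; right; exact: good_z.
exact: good_term2_word.
Qed.

Lemma in_mu_cnorm r s : (0 < r)%N -> in_mu r s -> cnorm s = 1.
Proof.
move=> r0 sr; apply/eqP; rewrite -(@pexpr_eq1 _ (cnorm s) r) ?cnorm_ge0 // -cnormX sr.
by apply/eqP; exact: cnorm1.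
Qed.

Lemma Forall_all (P : letter R -> Prop) (a : pred (letter R)) w :
  (forall x, P x -> a x) -> List.Forall P w -> all a w.
Proof.
move=> aP; elim: w => // x w IH H.
by rewrite /= (aP _ (List.Forall_inv H)) IH //; exact: List.Forall_inv_tail H.
Qed.

Lemma ends_with_y_yend w : ends_with_y w -> yend w && ~~ nilp w.
Proof.
move=> [w' [s ->]]; rewrite andbC /nilp size_rcons /=.
by case: w' => // a w'; rewrite rcons_cons /= last_rcons.
Qed.

End Admissible.

Theorem theorem3p20 (R : realType) (r : nat) (s : Cplx R)
    (w w' : ncpoly R) (m : nat) :
  (0 < r)%N -> in_mu r s -> in_A1pos_mu r w -> in_A1pos_one w' ->
  \sum_(0 <= k < m) Lsh (term1 s w k) * Lsh (term2 w' (m - k)%N)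
    = Lsh (term1 s (harm w w') m).
Proof.
move=> r0 /(in_mu_cnorm r0) s1 Hw Hw'.
rewrite Lsh_term1 lin_ext_lift_prod.
(* Both sides are bilinear in [w] and [w'], so it suffices to compare them on pairs of words. *)
transitivity (lin_ext (fun u => lin_ext (fun u' =>
    \sum_(0 <= k < m) term1_word s k (Iw (Mw s u)) * term2_word (m - k).-1 u') w') w).
  under [RHS]eq_lin_ext do rewrite lin_ext_sum.
  rewrite lin_ext_sum !big_nat; apply: eq_bigr => k /andP[_ km].
  rewrite Lsh_term1 Lsh_term2 ?subn_gt0 // mulrC -lin_extZ.
  by apply: eq_lin_ext => u; rewrite mulrC -lin_extZ.
apply: eq_lin_ext_Forall; apply: List.Forall_impl Hw => x [/ends_with_y_yend/andP[yx nx] ux].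
apply: eq_lin_ext_Forall; apply: List.Forall_impl Hw' => x' [/ends_with_y_yend/andP[yx' nx'] ux'].
apply: word_identity => //.
  by apply: Forall_all ux => -[|t] //= /(in_mu_cnorm r0) t1; rewrite /unit_letter t1.
by apply: Forall_all ux' => -[|t] //= ->; rewrite /one_letter.
Qed.
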